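(* Let $x\in(0,1)$ be non-dyadic. There exists a bounded linear extension operator $T:\mathrm{dom}\,\mathcal{E}_{\Omega_x^+}\to\mathrm{dom}\,\mathcal{E}$ (i.e. a linear map with $Tu|_{\Omega_x^+}=u$ for all $u$, bounded with respect to energy) if and only if $x$ satisfies the nonconsecutive condition. In that case the bound on $T$ is $O\left(\left(\frac{10}{3}\right)^{N/2}\right)$: there is a constant $C$, independent of $x$ and $N$, such that if $x$ satisfies the nonconsecutive condition with bound $N$ then $T$ can be chosen with $$\mathcal{E}(Tu)^{1/2}\le C\left(\tfrac{10}{3}\right)^{N/2}\mathcal{E}_{\Omega_x^+}(u)^{1/2}\quad\text{for all }u\in\mathrm{dom}\,\mathcal{E}_{\Omega_x^+}.$$
   Context: Let $q_0,q_1,q_2$ be the vertices of an equilateral triangle of height $1$ in the plane, $q_0$ on top and $q_1q_2$ horizontal; $F_i(p)=(p+q_i)/2$; $\mathcal{SG}$ is the Sierpinski gasket, i.e. the attractor of $F_0,F_1,F_2$. An $n$-cell is a set $F_{i_1}\cdots F_{i_n}(\mathcal{SG})$; its vertices are the images of $q_0,q_1,q_2$. Let $x\in(0,1)$ be not a dyadic rational, written uniquely as $x=\sum_{k\ge1}2^{-n_k}$ with integers $0<n_1<n_2<\cdots$ (infinite sequence). Let $L_x$ be the horizontal line at distance $x$ below $q_0$, $S(x)=\mathcal{SG}\cap L_x$, and $\Omega_x^+$ the set of points of $\mathcal{SG}$ strictly above $L_x$. $x$ satisfies the nonconsecutive condition with bound $N$ if there are no $N$ consecutive integers in the sequence $\{n_m\}$;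 it satisfies the nonconsecutive condition if this holds for some $N$. Energy: $\mathcal{E}(u)=\lim_{n\to\infty}\left(\frac53\right)^n\sum_C\sum_{\{p,q\}}(u(p)-u(q))^2$ where $C$ runs over all $n$-cells and $\{p,q\}$ over the three pairs of distinct vertices of $C$; $\mathrm{dom}\,\mathcal{E}$ is the space of continuous functions on $\mathcal{SG}$ with $\mathcal{E}(u)<\infty$. Similarly $\mathcal{E}_{\Omega_x^+}(u)=\lim_{m\to\infty}\left(\frac53\right)^{n_m}\sum_C\sum_{\{p,q\}}(u(p)-u(q))^2$ with $C$ running over the $n_m$-cells contained in $\Omega_x^+$, and $\mathrm{dom}\,\mathcal{E}_{\Omega_x^+}$ is the space of functions, continuous on $\Omega_x^+\cup S(x)$, with $\mathcal{E}_{\Omega_x^+}(u)<\infty$. Boundedness of $T$ means $\mathcal{E}(Tu)^{1/2}\le B\,\mathcal{E}_{\Omega_x^+}(u)^{1/2}$ for all $u$ and some finite $B$ (the bound on $T$). *)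

(* Defs.v *)
From HB Require Import structures.
From mathcomp Require Import all_boot all_order all_algebra.
From mathcomp Require Import all_classical all_reals all_analysis.
From mathcomp Require Import lra.
Set Implicit Arguments.
Unset Strict Implicit.
Unset Printing Implicit Defensive.
Import Order.TTheory GRing.Theory Num.Theory.
Import numFieldNormedType.Exports.
Local Open Scope classical_set_scope.
Local Open Scope ring_scope.

Section SierpinskiGasket.
Context {R : realType}.

(* Height 1, hence side 2 / sqrt 3. *)
Definition q (i : 'I_3) : R * R :=
  if i == 0%N :> nat then (0, 1)
  else if i == 1%N :> nat then (- (Num.sqrt 3)^-1, 0)
  else ((Num.sqrt 3)^-1, 0).

Definition F (i : 'I_3) (p : R * R) : R * R := 2^-1 *: (p + q i).

Definition attractor (K : set (R * R)) : Prop :=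
  [/\ compact K, K !=set0 & K = \bigcup_(i in [set: 'I_3]) (F i @` K)].

Definition SG : set (R * R) := get attractor.

(* SG_attractor and attractor_unique show that SG is well defined. *)

Let box : set (R * R) := `[-1, 1]%classic `*` `[0, 1]%classic.
Let F_iter (n : nat) : set (R * R) :=
  iter n (fun K => \bigcup_(i in [set: 'I_3]) (F i @` K)) box.

Let F_continuous i : continuous (F i).
Proof.
move=> p; apply: (@continuous_comp _ _ _ (fun x : R * R => x + q i) (fun x : R * R => 2^-1 *: x)).

  by apply: (@cvgD R (R * R)%type); [exact: cvg_id | exact: cvg_cst].
exact: (@scaler_continuous R (R * R)%type).
Qed.

Let F_inj i : injective (F i).
Proof.
move=> a b /(congr1 (fun z => 2 *: z)).
by rewrite /F !scalerA divff ?pnatr_eq0// !scale1r => /addIr.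
Qed.

Let F_box i : F i @` box `<=` box.
Proof.
have s0 : 0 <= (Num.sqrt 3 : R)^-1 by rewrite invr_ge0 sqrtr_ge0.
have s1 : (Num.sqrt 3 : R)^-1 <= 1.
  rewrite invf_le1 ?sqrtr_gt0; last by lra.
  by rewrite -{1}sqrtr1 ler_sqrt; lra.
move=> p [[a b] [/=]]; rewrite !in_itv/= => /andP[a0 a1] /andP[b0 b1] <-.
rewrite /F /q; case: ifP => _; [|case: ifP => _];
  split; rewrite /= ?in_itv/= /GRing.scale/=; apply/andP; split; lra.
Qed.

Let F_iter_compact n : compact (F_iter n).
Proof.
elim: n => [|n IH] /=; first by apply: compact_setX; exact: segment_compact.
rewrite (_ : [set: 'I_3] = [set` predT]); last by apply/seteqP; split.
rewrite bigcup_pred.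
apply: bigsetU_compact => i _; apply: continuous_compact => //.
exact/continuous_subspaceT/F_continuous.
Qed.

Let F_iterS n : F_iter n.+1 `<=` F_iter n.
Proof.
elim: n => [|n IH] /=; first by move=> p [i _ /F_box].
by move=> p [i _ [y /IH Yn <-]]; exists i => //; exists y.
Qed.

Let F_iter_le m n : (m <= n)%N -> F_iter n `<=` F_iter m.
Proof.
move=> /subnK <-; elim: (n - m)%N => // k IH.
by rewrite addSn; apply: subset_trans IH; exact: F_iterS.
Qed.

Let attractor_exists : exists K, attractor K.
Proof.
exists (\bigcap_n F_iter n); split.
- apply: (@subclosed_compact _ _ (F_iter 0)); last 2 first.
  + exact: F_iter_compact.
  + exact: bigcap_inf.
  apply: closed_bigI => n _; apply: compact_closed => //.
- exists (q ord0) => n _; elim: n => [|n IH].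
    by rewrite /F_iter/= /box /q/=; split; rewrite /= in_itv/=; lra.
  exists ord0 => //; exists (q ord0) => //.
  by rewrite /F /q/=; congr pair; rewrite /GRing.scale/=; lra.
- apply/seteqP; split=> p.
  + move=> Kp; apply: contrapT => nKp.
    have g i : exists n, forall y, F i y = p -> ~ F_iter n y.
      apply: contrapT => /forallNP h; apply: nKp; exists i => //.
      have /existsNP[y /not_implyP[Fy /contrapT _]] := h 0%N.
      exists y => // n _.
      have /existsNP[z /not_implyP[Fz /contrapT Kz]] := h n.
      by rewrite (F_inj (etrans Fy (esym Fz))).
    have [f fP] := choice g.
    have [i _ [y Ky yp]] := Kp (\max_i f i).+1 I.
    apply: (fP i y yp); apply: F_iter_le Ky.
    exact: leq_bigmax.
  + move=> [i _ [y Ky <-]] [|n] _; last by exists i => //; exists y => //; exact: Ky.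
    by apply: (@F_box i); exists y => //; exact: (Ky 0%N).
Qed.

Lemma SG_attractor : attractor SG.
Proof. exact: getPex attractor_exists. Qed.

Lemma attractor_unique (A B : set (R * R)) :
  attractor A -> attractor B -> A = B.
Proof.
suff sub C D : attractor C -> attractor D -> C `<=` D.
  by move=> hA hB; apply/seteqP; split; exact: sub.
move=> [cC _ CE] [cD [d0 Dd0] DE] c0 Cc0.
have [M [M0 hM]] : exists M, 0 < M /\ forall c d, C c -> D d -> `|c - d| <= M.
  have [M1 [_ h1]] := compact_bounded cC.
  have [M2 [_ h2]] := compact_bounded cD.
  exists ((`|M1| + 1) + (`|M2| + 1)); split.
    by have := normr_ge0 M1; have := normr_ge0 M2; lra.
  move=> c d Cc Dd; apply: le_trans (ler_normB _ _) _; apply: lerD.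
    by apply: h1 => //; have := ler_norm M1; lra.
  by apply: h2 => //; have := ler_norm M2; lra.
have near n c : C c -> exists2 d, D d & `|c - d| <= M / 2 ^+ n.
  elim: n c => [|n IH] c Cc; first by exists d0; rewrite // expr0 divr1 hM.
  have := Cc; rewrite CE => -[i _ [c' Cc' <-]].
  have [d' Dd' cd'] := IH _ Cc'.
  exists (F i d'); first by rewrite DE; exists i => //; exists d'.
  rewrite /F -scalerBr opprD addrACA subrr addr0 normrZ ger0_norm ?invr_ge0//.
  by rewrite exprS invfM mulrCA ler_pM2l ?invr_gt0.
apply: (compact_closed (@norm_hausdorff R (R * R)%type) cD) => U /nbhs_ballP[e /= e0 eU].
have [n ne] : exists n, M / 2 ^+ n < e.
  have Me : 0 <= M / e by rewrite divr_ge0 ?ltW.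
  exists (Num.bound (M / e)).
  rewrite ltr_pdivrMr ?exprn_gt0// mulrC -ltr_pdivrMr//.
  apply: lt_trans (archi_boundP Me) _.
  by rewrite -natrX ltr_nat ltn_expl.
have [d Dd cd] := near n _ Cc0.
exists d; split => //; apply: eU.
by rewrite -ball_normE/=; exact: le_lt_trans cd ne.
Qed.

(* F_(i_1) \o ... \o F_(i_n) for the word w = [:: i_1; ...; i_n] *)
Definition F_word (w : seq 'I_3) (p : R * R) : R * R := foldr F p w.

Definition cell (w : seq 'I_3) : set (R * R) := F_word w @` SG.

Definition cell_energy (u : R * R -> R) (w : seq 'I_3) : R :=
  \sum_(i < 3) \sum_(j < 3 | (i < j)%N)
    (u (F_word w (q i)) - u (F_word w (q j))) ^+ 2.

(* Distinct words of length n give distinct n-cells, so a sum over words is a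
   sum over cells.  Both this sequence and that of energy_above are
   nondecreasing, so the limits exist in \bar R for every u. *)
Definition energy (u : R * R -> R) : \bar R :=
  limn (fun n => ((5 / 3) ^+ n *
    \sum_(w : n.-tuple 'I_3) cell_energy u w)%:E).

(* Functions on a subset of the plane are represented by total functions, of
   which only the values on that subset matter. *)
Definition dom_energy : set (R * R -> R) :=
  [set u | {within SG, continuous u} /\ (energy u < +oo)%E].

Definition slice (x : R) : set (R * R) := SG `&` [set p | p.2 = 1 - x].

Definition above (x : R) : set (R * R) := SG `&` [set p | 1 - x < p.2].

Definition dyadic (x : R) : Prop :=
  exists (k : int) (m : nat), x = k%:~R / 2 ^+ m.

(* n k is the exponent n_(k+1). *)
Definition binary_expansion (x : R) (n : nat -> nat) : Prop :=
  [/\ (0 < n 0)%N, {homo n : i j / (i < j)%N} &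
      series (fun k => (2 ^+ n k)^-1 : R) @ \oo --> x].

Definition energy_above (x : R) (n : nat -> nat) (u : R * R -> R) : \bar R :=
  limn (fun m => ((5 / 3) ^+ n m *
    \sum_(w : (n m).-tuple 'I_3 | `[< cell w `<=` above x >])
      cell_energy u w)%:E).

Definition dom_energy_above (x : R) (n : nat -> nat) : set (R * R -> R) :=
  [set u | {within above x `|` slice x, continuous u} /\
           (energy_above x n u < +oo)%E].

(* The second clause says that T acts on functions on above x `|` slice x,
   that is, T u does not depend on the values of u elsewhere. *)
Definition linear_extension (x : R) (n : nat -> nat)
    (T : (R * R -> R) -> (R * R -> R)) : Prop :=
  [/\ forall u, dom_energy_above x n u -> dom_energy (T u),
      forall u v, dom_energy_above x n u -> dom_energy_above x n v ->
        (forall p, (above x `|` slice x) p -> u p = v p) ->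
        forall p, SG p -> T u p = T v p,
      forall (a : R) u v, dom_energy_above x n u -> dom_energy_above x n v ->
        forall p, SG p -> T (fun r => a * u r + v r) p = a * T u p + T v p &
      forall u, dom_energy_above x n u -> forall p, above x p -> T u p = u p].

Definition energy_bound (x : R) (n : nat -> nat)
    (T : (R * R -> R) -> (R * R -> R)) (B : R) : Prop :=
  forall u, dom_energy_above x n u ->
    (sqrte (energy (T u)) <= B%:E * sqrte (energy_above x n u))%E.

End SierpinskiGasket.

Definition nonconsecutive (n : nat -> nat) (N : nat) : Prop :=
  ~ exists k : nat, forall j, (j < N)%N -> exists m, n m = (k + j)%N.

(* Main.v *)
From HB Require Import structures.
Require Import Defs.
From mathcomp Require Import all_boot all_order all_algebra.
From mathcomp Require Import all_classical all_reals all_analysis.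
From mathcomp Require Import ring lra zify.
Set Implicit Arguments.
Unset Strict Implicit.
Unset Printing Implicit Defensive.
Import Order.TTheory GRing.Theory Num.Theory.
Import numFieldNormedType.Exports.
Local Open Scope classical_set_scope.
Local Open Scope ring_scope.

(** Read the binary digits b of x from the top: an n-cell crossed by L_x has its
    top third above L_x and its two lower thirds crossed when the next digit is
    1, and its top third crossed and its two lower thirds below L_x when the
    next digit is 0.  To extend u, keep on every crossed cell the value of u at
    its top vertex and one common value beta at its two bottom vertices; beta is
    inherited through digits 1 and reset to the top value at each digit 0, where
    the two lower thirds are filled in harmonically.  Induction on the level
    bounds the energy of the extension of a crossed cell by
    K * (energy above) + c_s * (top value - beta)^2, where s bounds the number
    of digits 1 before the next 0: each digit 1 doubles the number of crossed
    cells and multiplies conductances by 5/3, which is the factor 10/3 per digit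
    in c_s, and the difference along an edge is absorbed as by resistors in
    series.  Finite energy on all levels makes the vertex values Hoelder, so that
    they extend continuously to SG.

    Conversely, given a run of m+1 digits 1 after a crossed k-cell, take u to be
    0 above L_x in its left third, 1 above L_x in its right third, harmonic on
    its top third, and 0 elsewhere, with energy of order (5/3)^k.  Two crossed
    cells of level k+m+1, with values 0 and 1 at their tops, share a bottom
    vertex, so any extension has energy at least (5/3)^(k+m+1)/2. *)

(** * Vertex values on words, renormalised energies and harmonic extension *)

Definition o0 : 'I_3 := Ordinal (isT : (0 < 3)%N).
Definition o1 : 'I_3 := Ordinal (isT : (1 < 3)%N).
Definition o2 : 'I_3 := Ordinal (isT : (2 < 3)%N).

Lemma I3_ind (P : 'I_3 -> Prop) : P o0 -> P o1 -> P o2 -> forall i, P i.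
Proof.
move=> h0 h1 h2 [[|[|[|//]]] h].
- by rewrite (_ : Ordinal h = o0) //; exact: val_inj.
- by rewrite (_ : Ordinal h = o1) //; exact: val_inj.
- by rewrite (_ : Ordinal h = o2) //; exact: val_inj.
Qed.

Lemma sum_I3 (V : nmodType) (f : 'I_3 -> V) : \sum_i f i = f o0 + f o1 + f o2.
Proof.
rewrite !big_ord_recl big_ord0 addr0 addrA.
by congr (f _ + f _ + f _); exact: val_inj.
Qed.

Section Families.
Context {R : realFieldType}.
Implicit Types (v : 'I_3 -> R) (b : nat -> bool) (w : seq 'I_3).

(* V w j stands for the value at the vertex F_w(q_j); compatibility says that
   this depends on the vertex only. *)
Definition vfamily := seq 'I_3 -> 'I_3 -> R.
Implicit Types U V : vfamily.

Definition compatible V :=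
  forall w i j, V (rcons w i) j = V (rcons w j) i /\ V (rcons w i) i = V w i.

Lemma compatible_cons V i : compatible V -> compatible (V \o cons i).
Proof. by move=> cV w j k; exact: (cV (i :: w)). Qed.

Lemma compatible_of_cons V :
  (forall i j, V [:: i] j = V [:: j] i) -> (forall i, V [:: i] i = V [::] i) ->
  (forall i, compatible (V \o cons i)) -> compatible V.
Proof.
by move=> h1 h2 h [|k w] i j; [split; [exact: h1|exact: h2]|exact: (h k)].
Qed.

Definition edge_energy v : R :=
  (v o0 - v o1) ^+ 2 + (v o0 - v o2) ^+ 2 + (v o1 - v o2) ^+ 2.

Lemma edge_energy_ge0 v : 0 <= edge_energy v.
Proof. by rewrite !addr_ge0 ?sqr_ge0. Qed.

Lemma edge_energy_ge v i j : (v i - v j) ^+ 2 <= edge_energy v.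
Proof.
rewrite /edge_energy; have := sqr_ge0 (v o0 - v o1).
have := sqr_ge0 (v o0 - v o2); have := sqr_ge0 (v o1 - v o2).
by elim/I3_ind: i; elim/I3_ind: j => *; lra.
Qed.

(** The renormalised sum over [n]-cells (see [level_energyE]), unfolded from the first letter so
    that inductions pass to the three subcells. *)
Fixpoint level_energy V n : R :=
  if n is m.+1 then 5 / 3 * \sum_i level_energy (V \o cons i) m
  else edge_energy (V [::]).

Lemma eq_level_energy U V n :
  (forall w j, U w j = V w j) -> level_energy U n = level_energy V n.
Proof.
elim: n U V => [|n IH] U V UV /=; first by rewrite /edge_energy !UV.
by congr (_ * _); apply: eq_bigr => i _; apply: IH => w j; exact: UV.
Qed.

Lemma level_energy_ge0 V n : 0 <= level_energy V n.
Proof.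
elim: n V => [|n IH] V /=; first exact: edge_energy_ge0.
by rewrite mulr_ge0 ?sumr_ge0 //; lra.
Qed.

Lemma level_energy_cst V n :
  (forall w i j, V w i = V w j) -> level_energy V n = 0.
Proof.
elim: n V => [|n IH] V h /=.
  by rewrite /edge_energy (h _ o0 o1) (h _ o2 o1) subrr expr0n !addr0.
by rewrite big1 ?mulr0 // => i _; apply: IH => w j k; exact: h.
Qed.

Lemma level_energy_ge V w :
  (5 / 3) ^+ size w * edge_energy (V w) <= level_energy V (size w).
Proof.
elim: w V => [|i w IH] V /=; first by rewrite mul1r.
rewrite exprS -mulrA ler_pM2l; last by lra.
apply: le_trans (IH (V \o cons i)) _.
by rewrite [leRHS](bigD1 i) //= lerDl sumr_ge0 // => *; exact: level_energy_ge0.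
Qed.

(** At the first letter where the words differ they fall into different summands, so their
    contributions add up. *)
Lemma level_energy_ge2 V w w' : w != w' -> size w = size w' ->
  (5 / 3) ^+ size w * (edge_energy (V w) + edge_energy (V w'))
  <= level_energy V (size w).
Proof.
elim: w w' V => [|i w IH] [|j w'] V //= ne [sz].
rewrite exprS -mulrA ler_pM2l; last by lra.
have ge0 k := level_energy_ge0 (V \o cons k) (size w).
have [ij|ij] := eqVneq i j.
  subst j; rewrite eqseq_cons eqxx /= in ne.
  apply: le_trans (IH w' (V \o cons i) ne sz) _.
  by rewrite [leRHS](bigD1 i) //= lerDl sumr_ge0.
rewrite mulrDr (bigD1 i) //= (bigD1 j) ?(eq_sym j) //=; apply: lerD.
  exact: (level_energy_ge (V \o cons i)).
rewrite sz; apply: le_trans (level_energy_ge (V \o cons j) w') _.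
by rewrite lerDl sumr_ge0 // => k _; rewrite -sz.
Qed.

(* Equality holds for [harmonic_child] below; s, t and r in the proof are the
   deviations from it at the three midpoints. *)
Lemma level_energy_step V : compatible V ->
  edge_energy (V [::]) <= 5 / 3 * \sum_i edge_energy (V [:: i]).
Proof.
move=> cV; rewrite sum_I3 /edge_energy.
have [e01 e0] := cV [::] o0 o1; have [e12 e1] := cV [::] o1 o2.
have [e20 e2] := cV [::] o2 o0; move: e01 e12 e20 e0 e1 e2 => /= -> <- -> -> -> ->.
move: (V [::] o0) (V [::] o1) (V [::] o2) (V [:: o1] o0) (V [:: o1] o2)
  (V [:: o0] o2) => x y z a c d.
pose s := a - (2 * x + 2 * y + z) / 5; pose t := c - (2 * y + 2 * z + x) / 5.
pose r := d - (2 * x + 2 * z + y) / 5.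
rewrite -subr_ge0 (_ : _ - _ = 5 / 3 * (2 * s ^+ 2 + 2 * t ^+ 2 + 2 * r ^+ 2 +
  (s - t) ^+ 2 + (t - r) ^+ 2 + (r - s) ^+ 2)); last by rewrite /s /t /r; field.
rewrite mulr_ge0 //.
have := sqr_ge0 s; have := sqr_ge0 t; have := sqr_ge0 r.
have := sqr_ge0 (s - t); have := sqr_ge0 (t - r); have := sqr_ge0 (r - s).
move: {s t r}(s ^+ 2) (t ^+ 2) (r ^+ 2) ((s - t) ^+ 2) ((t - r) ^+ 2)
  ((r - s) ^+ 2) => *; lra.
Qed.

Lemma level_energy_nondecreasing V m n : compatible V -> (m <= n)%N ->
  level_energy V m <= level_energy V n.
Proof.
move=> cV /subnK <-; elim: (n - m)%N => // k; rewrite addSn => /le_trans; apply.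
elim: (k + m)%N V cV => [|{}n IH] V cV; first exact: level_energy_step.
rewrite [leLHS]/= [leRHS]/= ler_pM2l; last by lra.
by apply: ler_sum => i _; apply: IH; exact: compatible_cons.
Qed.

(** The 1/5-2/5 rule: the midpoint between corners [i] and [j] gets [(2 v i + 2 v j + v k) / 5], [k]
    being the third corner, in a form symmetric in [i] and [j]. *)
Definition harmonic_child v i : 'I_3 -> R := fun j =>
  if j == i then v i else (v i + v j + v o0 + v o1 + v o2) / 5.

Fixpoint harmonic v w : 'I_3 -> R :=
  if w is i :: w' then harmonic (harmonic_child v i) w' else v.

Lemma harmonic_compatible v : compatible (harmonic v).
Proof.
move=> w; elim: w v => [|k w IH] v i j; last exact: IH.
rewrite /= /harmonic_child eqxx; split => //.
by rewrite eq_sym; case: eqVneq => [->//|_]; rewrite [v j + v i]addrC.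
Qed.

Lemma level_energy_harmonic v n : level_energy (harmonic v) n = edge_energy v.
Proof.
elim: n v => //= n IH v.
have E i : level_energy (harmonic v \o cons i) n =
  edge_energy (harmonic_child v i) by exact: IH.
rewrite sum_I3 !E.
by rewrite /edge_energy /harmonic_child /=; field.
Qed.

Lemma harmonic_cst (c : R) v w i : (forall j, v j = c) -> harmonic v w i = c.
Proof.
elim: w v => [|k w IH] v h /=; first exact: h.
by apply: IH => j; rewrite /harmonic_child; case: ifP => _; rewrite !h //; field.
Qed.

(** * Cells above the line and cells crossed by it *)

Definition shift b := fun k => b k.+1.

(** Reads off the digits alone whether a cell lies above [L_x], as [crossing_word] does for being
    crossed; [cell_above] and [top_above] give the link to geometry. *)
Fixpoint above_word b w : bool :=
  if w is i :: w' then
    if b 0%N then (i == o0) || above_word (shift b) w'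
    else (i == o0) && above_word (shift b) w'
  else false.

Fixpoint crossing_word b w : bool :=
  if w is i :: w' then
    (b 0%N == (i != o0)) && crossing_word (shift b) w'
  else true.

Fixpoint above_energy b U n : R :=
  if n is m.+1 then
    5 / 3 * (if b 0%N then
               level_energy (U \o cons o0) m +
               (above_energy (shift b) (U \o cons o1) m +
                above_energy (shift b) (U \o cons o2) m)
             else above_energy (shift b) (U \o cons o0) m)
  else 0.

Lemma above_energy_ge0 b U n : 0 <= above_energy b U n.
Proof.
elim: n b U => //= n IH b U; rewrite mulr_ge0 //.
by case: ifP => _; rewrite // !addr_ge0 ?level_energy_ge0.
Qed.

(** On cells already above, [level_energy_nondecreasing] applies; newly exposed cells add
    nonnegative terms. *)
Lemma above_energy_nondecreasing b U m n : compatible U -> (m <= n)%N ->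
  above_energy b U m <= above_energy b U n.
Proof.
move=> cU /subnK <-; elim: (n - m)%N => // k; rewrite addSn => /le_trans; apply.
elim: (k + m)%N b U cU => [|{}n IH] b U cU; first exact: above_energy_ge0.
rewrite [leLHS]/= [leRHS]/= ler_pM2l; last by lra.
have cU' i := compatible_cons i cU.
case: ifP => _; last exact: IH.
apply: lerD; first exact: (@level_energy_nondecreasing _ n n.+1).
by apply: lerD; exact: IH.
Qed.

(** * The extension operator on vertex values *)

Definition crossing_value (beta : R) U : 'I_3 -> R := fun j =>
  if j == o0 then U [::] o0 else beta.

(* On a crossing cell the extension takes the value of U at the top vertex and
   beta at the two others.  At a digit 0 beta is reset to the top value, so that
   the lower two thirds are harmonic with vertex values (top, beta, beta). *)
Fixpoint extension b (beta : R) U w : 'I_3 -> R :=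
  if w is i :: w' then
    if b 0%N then
      if i == o0 then U w else extension (shift b) beta (U \o cons i) w'
    else if i == o0 then extension (shift b) (U [::] o0) (U \o cons i) w'
    else harmonic (crossing_value beta U) w'
  else crossing_value beta U.

(** Only vertices strictly above [L_x] are read, so the operator built from [extension] ignores the
    values of a function elsewhere. *)
Lemma eq_extension b beta U V w j :
  (forall w j, above_word b w || crossing_word b w && (j == o0) ->
    U w j = V w j) ->
  extension b beta U w j = extension b beta V w j.
Proof.
elim: w b beta U V => [|i w IH] b beta U V h /=.
  by rewrite /crossing_value; case: ifP => // _; rewrite h.
case: ifP => b0; case: ifP => i0.
- by rewrite h //= b0 i0.
- by apply: IH => w' k h'; apply: h; rewrite /= b0 i0 /=.
- by rewrite (h [::] o0) //; apply: IH => w' k h'; apply: h; rewrite /= b0 i0 /=.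
- by rewrite /crossing_value (h [::] o0).
Qed.

Lemma harmonic_linear a u v v' w j : (forall k, u k = a * v k + v' k) ->
  harmonic u w j = a * harmonic v w j + harmonic v' w j.
Proof.
elim: w u v v' => //= i w IH u v v' h; apply: IH => k.
by rewrite /harmonic_child; case: ifP => _; rewrite !h //; field.
Qed.

Lemma extension_linear b a beta gamma U V w j :
  extension b (a * beta + gamma) (fun w j => a * U w j + V w j) w j =
  a * extension b beta U w j + extension b gamma V w j.
Proof.
have cross beta' gamma' U' V' k : crossing_value (a * beta' + gamma')
    (fun w j => a * U' w j + V' w j) k =
    a * crossing_value beta' U' k + crossing_value gamma' V' k.
  by rewrite /crossing_value; case: ifP.
elim: w b beta gamma U V => [|i w IH] b beta gamma U V /=; first exact: cross.
case: ifP => _; case: ifP => _ //.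
- exact: (IH _ _ _ (U \o cons i) (V \o cons i)).
- exact: (IH _ _ _ (U \o cons i) (V \o cons i)).
- exact: harmonic_linear.
Qed.

Lemma extension_above b beta U w j :
  above_word b w -> extension b beta U w j = U w j.
Proof.
elim: w b beta U => //= i w IH b beta U.
by case: ifP => _; case: ifP => //= _ h; rewrite IH.
Qed.

Lemma extension_crossing b beta U w :
  compatible U -> crossing_word b w -> extension b beta U w o0 = U w o0.
Proof.
elim: w b beta U => //= i w IH b beta U cU.
case: (b 0%N); case: (i == o0) => //= h; apply: IH => //; exact: compatible_cons.
Qed.

(** At a digit 1 the lower thirds keep the values of [U] at their tops and share [beta]; at a digit
    0 the reset gives the top third the top value at its bottom vertices, which is also the value at
    the tops of the harmonic thirds. *)
Lemma extension_compatible b beta U :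
  compatible U -> compatible (extension b beta U).
Proof.
move=> cU w; elim: w b beta U cU => [|k w IH] b beta U cU; last first.
  move=> i j; rewrite /=; have cU' := compatible_cons k cU.
  case: ifP => _; case: ifP => // _; try exact: IH.
    by case: (cU' w i j).
  exact: harmonic_compatible.
have cU0 i j := (cU [::] i j).1; have cU1 i := (cU [::] i i).2.
rewrite /= in cU0 cU1.
elim/I3_ind; elim/I3_ind; rewrite /= /crossing_value /= ?cU1; case: (b 0%N);
  split => //=; rewrite ?cU1 //; exact: cU0.
Qed.

(* 1/c = 1/k + 1/l is the conductance law of resistors in series. *)
Lemma sqr_add_series (c k l x y : R) : 0 < c -> 0 < k -> 0 < l ->
  c^-1 = k^-1 + l^-1 -> c * (x + y) ^+ 2 <= k * x ^+ 2 + l * y ^+ 2.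
Proof.
move=> c0 k0 l0 e.
have k1 : k != 0 by rewrite gt_eqF.
have l1 : l != 0 by rewrite gt_eqF.
have kl : k + l != 0 by rewrite gt_eqF // addr_gt0.
have -> : c = k * l / (k + l).
  by apply: invr_inj; rewrite e; field; rewrite k1 l1 kl.
rewrite -subr_ge0 (_ : _ - _ = (k * x - l * y) ^+ 2 / (k + l)).
  by rewrite divr_ge0 ?sqr_ge0 // ltW ?addr_gt0.
by field; rewrite kl.
Qed.

(** * Energy estimate for the extension *)

Section Bound.
Variable L : nat.

(* crossing_cost s bounds the cost, per unit of (U top - beta)^2, of a crossing
   cell whose next digit 0 comes after at most s digits 1.  Its inverse solves
   1/c_s = 10/3 * 1/c_(s+1) + 1/K with c_0 = 20/3, where K = bound_cst is so
   large that c_s > 0 for s <= L, and bound_slack = 3/(7K). *)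
Definition bound_slack : R := 3 / 40 * (3 / 10) ^+ L.
Definition bound_cst : R := 40 / 7 * (10 / 3) ^+ L.
Definition crossing_cost s : R :=
  ((3 / 10) ^+ s * (3 / 20 + bound_slack) - bound_slack)^-1.

Let r310 n : 0 < (3 / 10) ^+ n :> R. Proof. by rewrite exprn_gt0 //; lra. Qed.

Lemma bound_slack_gt0 : 0 < bound_slack.
Proof. by rewrite mulr_gt0 //; lra. Qed.

Lemma bound_cstE : bound_cst^-1 = 7 / 3 * bound_slack.
Proof.
rewrite /bound_cst /bound_slack invfM -exprVn.
rewrite (_ : (10 / 3)^-1 = 3 / 10 :> R); last by field.
by field.
Qed.

Lemma crossing_costV_gt0 s : (s <= L)%N -> 0 < (crossing_cost s)^-1.
Proof.
move=> sL; rewrite /crossing_cost invrK.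
have s0 := bound_slack_gt0; have h := r310 s.
have : (3 / 10) ^+ L <= (3 / 10) ^+ s :> R by rewrite ler_wiXn2l //; lra.
move=> h'; have : bound_slack <= 3 / 40 * (3 / 10) ^+ s.
  by rewrite /bound_slack ler_pM2l //; lra.
have := mulr_gt0 h s0; nra.
Qed.

Lemma crossing_cost_gt0 s : (s <= L)%N -> 0 < crossing_cost s.
Proof. by move=> /crossing_costV_gt0; rewrite invr_gt0. Qed.

Lemma crossing_cost0 : crossing_cost 0 = 20 / 3.
Proof. by rewrite /crossing_cost expr0 mul1r addrK; field. Qed.

Lemma crossing_cost_ge s : (s <= L)%N -> 20 / 3 <= crossing_cost s.
Proof.
move=> sL; have c0 := crossing_cost_gt0 sL.
rewrite -crossing_cost0 -lef_pV2 ?posrE //; last by rewrite crossing_cost0; lra.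
rewrite /crossing_cost !invrK expr0 mul1r lerD2r.
rewrite ger_pMl ?exprn_ile1 //; try lra.
by have := bound_slack_gt0; lra.
Qed.

Lemma crossing_costS s :
  (crossing_cost s)^-1 = (3 / 10 * crossing_cost s.+1)^-1 + bound_cst^-1.
Proof.
by rewrite bound_cstE invfM /crossing_cost !invrK exprS; field.
Qed.

(** The index [s] varies in the induction: a digit 1 lowers it by one, a digit 0 restores it to [L]
    by the bound on all runs. When [beta] is the top value the last term vanishes. *)
Lemma level_energy_extension b beta U n s :
  compatible U -> (s <= L)%N -> (exists2 r, (r <= s)%N & ~~ b r) ->
  (forall k, exists2 r, (r <= L)%N & ~~ b (k + r)%N) ->
  level_energy (extension b beta U) n <=
  (bound_cst + 1) * above_energy b U n +
  crossing_cost s * (U [::] o0 - beta) ^+ 2.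
Proof.
elim: n b beta U s => [|n IH] b beta U s cU sL [r rs br] run.
  rewrite /= mulr0 add0r /edge_energy /crossing_value /= subrr expr0n addr0.
  rewrite -mulr2n -mulr_natl ler_wpM2r ?sqr_ge0 //.
  by have := crossing_cost_ge sL; lra.
have cU' i := compatible_cons i cU.
have run' k : exists2 r, (r <= L)%N & ~~ shift b (k + r)%N by exact: (run k.+1).
have K0 : 0 < bound_cst by rewrite mulr_gt0 ?exprn_gt0 //; lra.
rewrite /= sum_I3.
case b0: (b 0%N).
- case: r rs br => [|r] rs br; first by rewrite b0 in br.
  case: s sL rs => // s sL rs.
  have run1 : exists2 r, (r <= s)%N & ~~ shift b r by exists r.
  have EE i : i != o0 -> level_energy (extension b beta U \o cons i) n =
      level_energy (extension (shift b) beta (U \o cons i)) n.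
    by move=> /negPf i0; apply: eq_level_energy => w j; rewrite /= b0 i0.
  rewrite (@eq_level_energy _ (U \o cons o0)); last by move=> w j; rewrite /= b0.
  rewrite !EE //.
  have h i := IH (shift b) beta (U \o cons i) s (cU' i) (ltnW sL) run1 run'.
  have := h o1; have := h o2; rewrite /=.
  have {}EE : edge_energy (U [:: o0]) <= level_energy (U \o cons o0) n.
    exact: (@level_energy_nondecreasing (U \o cons o0) 0).
  have [e1 e2] : U [:: o1] o0 = U [:: o0] o1 /\ U [:: o2] o0 = U [:: o0] o2.
    by split; case: (cU [::] o0 o1); case: (cU [::] o0 o2).
  have e0 : U [:: o0] o0 = U [::] o0 by case: (cU [::] o0 o0).
  rewrite e1 e2 -e0; move: EE; rewrite /edge_energy.
  set a := U [:: o0] o0; set p := U [:: o0] o1; set t := U [:: o0] o2.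
  set E0 := level_energy _ _; set A1 := above_energy _ _ _.
  set A2 := above_energy _ _ _; set E1 := level_energy _ _.
  set E2 := level_energy _ _ => EE h2 h1.
  (* The weight 3/10 makes the two lower thirds, each with factor 5/3, return exactly
     [crossing_cost s.+1], since 2 * 5/3 * 3/10 = 1. *)
  have series d : crossing_cost s * (a - beta + d) ^+ 2 <=
     3 / 10 * crossing_cost s.+1 * (a - beta) ^+ 2 + bound_cst * d ^+ 2.
    apply: sqr_add_series => //; last exact: crossing_costS.
      exact/crossing_cost_gt0/ltnW.
    by rewrite mulr_gt0 ?crossing_cost_gt0 //; lra.
  have s1 := series (p - a); have s2 := series (t - a).
  rewrite (_ : a - beta + _ = p - beta) in s1; last by ring.
  rewrite (_ : a - beta + _ = t - beta) in s2; last by ring.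
  (* The edges of the top third are paid by its own energy: [bound_cst] times [E0] covers them, and
     the extra 1 in [bound_cst + 1] covers [E0] itself. *)
  have : bound_cst * ((p - a) ^+ 2 + (t - a) ^+ 2) <= bound_cst * E0.
    rewrite ler_pM2l //; apply: le_trans EE.
    by have := sqr_ge0 (p - t); nra.
  have := level_energy_ge0 (U \o cons o0) n; rewrite -/E0.
  lra.
(* After the reset the top third has no difference to pay for; the two harmonic thirds cost 5/3 * 2
   * 2 = 20/3, which is [crossing_cost 0]. *)
- have run1 : exists2 r, (r <= L)%N & ~~ shift b r.
    by have [r' rL br'] := run' 0%N; exists r'.
  have := IH (shift b) (U [::] o0) (U \o cons o0) L (cU' o0) (leqnn _) run1 run'.
  have -> : (U \o cons o0) [::] o0 = U [::] o0 by case: (cU [::] o0 o0).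
  rewrite subrr expr0n mulr0 addr0 => h.
  have EE i : i != o0 -> level_energy (extension b beta U \o cons i) n =
      2 * (U [::] o0 - beta) ^+ 2.
    move=> /negPf i0.
    rewrite (@eq_level_energy _ (harmonic (crossing_value beta U))); last first.
      by move=> w j; rewrite /= b0 i0.
    by rewrite level_energy_harmonic /edge_energy /crossing_value /=; ring.
  rewrite (@eq_level_energy _ (extension (shift b) (U [::] o0) (U \o cons o0)));
    last by move=> w j; rewrite /= b0.
  rewrite !EE //.
  have := crossing_cost_ge sL; have := sqr_ge0 (U [::] o0 - beta); nra.
Qed.

End Bound.

(** * Test families for the converse *)

Lemma extension_cst b (c : R) w j : extension b c (fun _ _ => c) w j = c.
Proof.
elim: w b => [|i w IH] b /=; first by rewrite /crossing_value; case: ifP.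
case: ifP => _; case: ifP => _ //; try exact: IH.
by apply: harmonic_cst => k; rewrite /crossing_value; case: ifP.
Qed.

(** For constant [U] no edge has to be absorbed, and after the first reset the top third is
    constant; so a single digit 0 yields a bound, without control over later runs. *)
Lemma level_energy_extension_cst b beta (c : R) n s : ~~ b s ->
  level_energy (extension b beta (fun _ _ => c)) n <=
  20 / 3 * (10 / 3) ^+ s * (c - beta) ^+ 2.
Proof.
have sq := sqr_ge0 (c - beta).
have p1 k : 1 <= (10 / 3) ^+ k :> R by rewrite exprn_ege1 //; lra.
elim: n b s => [|n IH] b s bs.
  rewrite /= /edge_energy /crossing_value /=.
  by have := p1 s; nra.
rewrite /= sum_I3; case b0: (b 0%N).
- case: s bs => [|s] bs; first by rewrite b0 in bs.
  have EE i : i != o0 ->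
      level_energy (extension b beta (fun _ _ => c) \o cons i) n =
      level_energy (extension (shift b) beta (fun _ _ => c)) n.
    by move=> /negPf i0; apply: eq_level_energy => w j; rewrite /= b0 i0.
  rewrite level_energy_cst; last by move=> w i j; rewrite /= b0.
  have := IH (shift b) s bs; rewrite !EE // [X in _ -> _ <= _ * X * _]exprS; lra.
- have EE i : i != o0 ->
      level_energy (extension b beta (fun _ _ => c) \o cons i) n =
      2 * (c - beta) ^+ 2.
    move=> /negPf i0; rewrite (@eq_level_energy _ (harmonic
      (crossing_value beta (fun _ _ => c)))); last first.
      by move=> w j; rewrite /= b0 i0.
    by rewrite level_energy_harmonic /edge_energy /crossing_value /=; ring.
  rewrite level_energy_cst; last first.
    move=> w i j; rewrite /= b0 /=.
    by rewrite !(extension_cst (shift b) c w).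
  by rewrite !EE //; have := p1 s; nra.
Qed.

(** A copy of [P] on the cell of [u], zero elsewhere; the pieces fit together when [P] vanishes at
    the three corners. *)
Fixpoint graft (u : seq 'I_3) (P : vfamily) w : 'I_3 -> R :=
  match u, w with
  | i :: u', j :: w' => if i == j then graft u' P w' else fun=> 0
  | _ :: _, [::] => fun=> 0
  | [::], _ => P w
  end.

Lemma graft0 u P j : (forall j, P [::] j = 0) -> graft u P [::] j = 0.
Proof. by case: u. Qed.

Lemma graft_cat u P w j : graft u P (u ++ w) j = P w j.
Proof. by elim: u => //= i u IH; rewrite eqxx. Qed.

Lemma graft_compatible u P : (forall j, P [::] j = 0) ->
  compatible P -> compatible (graft u P).
Proof.
move=> P0 cP; elim: u => //= k u IH; apply: compatible_of_cons => /=.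
- by move=> i j; case: ifP => _; case: ifP => _; rewrite ?graft0.
- by move=> i; case: ifP => _; rewrite ?graft0.
- move=> i; case ki: (k == i); last by move=> w j l /=; rewrite ki.
  by move=> w j l; have := IH w j l; rewrite /= ki.
Qed.

Lemma level_energy_graft u P n C : 0 <= C ->
  (forall m, level_energy P m <= C) ->
  level_energy (graft u P) n <= (5 / 3) ^+ size u * C.
Proof.
move=> C0 hP; elim: u n => [|i u IH] n; first by rewrite /= mul1r.
have p0 : 0 <= (5 / 3) ^+ size u :> R by rewrite exprn_ge0 //; lra.
case: n => [|n].
  rewrite /= /edge_energy subrr expr0n !addr0 mulr_ge0 // exprn_ge0 //; lra.
rewrite exprS -mulrA ler_pM2l; last by lra.
rewrite (bigD1 i) //= big1 ?addr0; last first.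
  by move=> j ji; apply: level_energy_cst => w k l /=; rewrite eq_sym (negPf ji).
apply: le_trans (IH n); rewrite le_eqVlt; apply/orP; left; apply/eqP.
by apply: eq_level_energy => w j; rewrite /= eqxx.
Qed.

Lemma eq_above_energy b U V n :
  (forall w j, U w j = V w j) -> above_energy b U n = above_energy b V n.
Proof.
elim: n b U V => //= n IH b U V UV; congr (_ * _).
have UV' i : forall w j, (U \o cons i) w j = (V \o cons i) w j.
  by move=> w j; exact: UV.
by case: ifP => _; rewrite ?(eq_level_energy _ (UV' o0)) ?(IH _ _ _ (UV' _)) //;
  congr (_ + (_ + _)); exact: IH.
Qed.

Lemma above_energy_cst b V n :
  (forall w i j, above_word b w -> V w i = V w j) -> above_energy b V n = 0.
Proof.
elim: n b V => //= n IH b V h; case: ifP => b0.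
- rewrite level_energy_cst; last by move=> w i j; apply: h; rewrite /= b0.
  by rewrite !IH ?addr0 ?mulr0 // => w i j hw; apply: h; rewrite /= b0 hw.
- by rewrite IH ?mulr0 // => w i j hw; apply: h; rewrite /= b0.
Qed.

Lemma above_energy_graft b u P n C : crossing_word b u -> 0 <= C ->
  (forall m, above_energy (fun k => b (size u + k)%N) P m <= C) ->
  above_energy b (graft u P) n <= (5 / 3) ^+ size u * C.
Proof.
move=> + C0; elim: u b n => [|i u IH] b n; first by rewrite /= mul1r => _ ->.
move=> /= /andP[bi cu] hP.
have p0 : 0 <= (5 / 3) ^+ size u :> R by rewrite exprn_ge0 //; lra.
case: n => [|n] /=; first by rewrite mulr_ge0 // exprn_ge0 //; lra.
rewrite exprS -[leRHS]mulrA ler_pM2l; last by lra.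
have z j : i != j -> forall w k, (graft (i :: u) P \o cons j) w k = 0.
  by move=> /negPf ij w k; rewrite /= ij.
have e : above_energy (shift b) (graft (i :: u) P \o cons i) n <=
    (5 / 3) ^+ size u * C.
  rewrite (@eq_above_energy _ _ (graft u P)); first exact: IH.
  by move=> w j; rewrite /= eqxx.
have az j : i != j -> above_energy (shift b) (graft (i :: u) P \o cons j) n = 0.
  by move=> ij; apply: above_energy_cst => w k l _; rewrite !z.
move: bi e z az; case: (b 0%N).
- elim/I3_ind: i => // _ e z az; rewrite level_energy_cst ?add0r.
  + by rewrite (az o2) // addr0.
  + by move=> w k l; rewrite !z.
  + by rewrite (az o1) // add0r.
  + by move=> w k l; rewrite !z.
- by elim/I3_ind: i.
Qed.

Lemma crossing_word_cat b u w : crossing_word b (u ++ w) =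
  crossing_word b u && crossing_word (fun k => b (size u + k)%N) w.
Proof. by elim: u b => //= i u IH b; rewrite IH andbA. Qed.

Lemma crossing_word_ones b w : (forall j, (j < size w)%N -> b j) ->
  all (predC1 o0) w -> crossing_word b w.
Proof.
elim: w b => //= i w IH b h /andP[i0 hw].
by rewrite h // i0 IH // => j jw; exact: (h j.+1).
Qed.

Lemma crossing_word_exists b n : exists2 w, size w = n & crossing_word b w.
Proof.
elim: n b => [|n IH] b; first by exists [::].
have [w <- cw] := IH (shift b).
by exists ((if b 0%N then o1 else o0) :: w) => //=; rewrite cw; case: (b 0%N).
Qed.

(* Above the line this is 0 on the left third and 1 on the right third of a cell
   whose first digit is 1. *)
Definition jump b : vfamily := fun w =>
  if w is i :: w' then
    if i == o0 then harmonic (fun j => (j == o2)%:R) w'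
    else if i == o1 then fun=> 0
    else extension (shift b) 0 (fun _ _ => 1) w'
  else fun=> 0.

Lemma jump_compatible b : compatible (jump b).
Proof.
apply: compatible_of_cons.
- by elim/I3_ind; elim/I3_ind.
- by elim/I3_ind.
- elim/I3_ind.
  + exact: harmonic_compatible.
  + by [].
  + exact: extension_compatible.
Qed.

(** Finiteness makes the test function continuous; [C] grows with the distance to the digit 0, in
    contrast to the bound on [above_energy]. *)
Lemma level_energy_jump b s : ~~ b s.+1 ->
  exists2 C, 0 <= C & forall n, level_energy (jump b) n <= C.
Proof.
move=> bs; have p : 0 <= (10 / 3) ^+ s :> R by rewrite exprn_ge0 //; lra.
exists (5 / 3 * (2 + 20 / 3 * (10 / 3) ^+ s)); first by lra.
case=> [|n]; first by rewrite /= /edge_energy subrr expr0n !addr0 /=; lra.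
rewrite /= ler_pM2l; last by lra.
rewrite sum_I3.
have -> : level_energy (jump b \o cons o0) n = 2.
  by rewrite (level_energy_harmonic (fun j => (j == o2)%:R)) /edge_energy /=; ring.
rewrite [X in _ + X + _]level_energy_cst // addr0 lerD2l.
apply: le_trans (level_energy_extension_cst 0 1 n bs) _.
by rewrite subr0 expr1n mulr1.
Qed.

(** Above the line the left and right thirds are constant, so only the top third counts, with 5/3 *
    2, however long the run of digits 1. *)
Lemma above_energy_jump b n : b 0%N -> above_energy b (jump b) n <= 10 / 3.
Proof.
move=> b0; case: n => [|n] /=; first by lra.
rewrite b0.
have -> : level_energy (jump b \o cons o0) n = 2.
  by rewrite (level_energy_harmonic (fun j => (j == o2)%:R)) /edge_energy /=; ring.
rewrite !above_energy_cst ?addr0; first by lra.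
- by move=> w i j hw; rewrite /= !extension_above.
- by [].
Qed.
End Families.

(** * Sequences with geometrically decreasing increments *)

Lemma geometric_increments_cvg (R : realType) (u : nat -> R) (C : R) :
  (forall n, `|u n.+1 - u n| <= 2 * C * (4 / 5) ^+ n) ->
  cvgn u /\ forall n, `|limn u - u n| <= 10 * C * (4 / 5) ^+ n.
Proof.
move=> h.
have C0 : 0 <= C by have := le_trans (normr_ge0 _) (h 0%N); rewrite expr0; lra.
(* The tail of the increments, with 2 C / (1 - 4/5) = 10 C; [u - e] increases, [u + e] decreases,
   and [u] lies between them. *)
pose e n : R := 10 * C * (4 / 5) ^+ n.
have e0 n : 0 <= e n by rewrite mulr_ge0 ?exprn_ge0 //; lra.
have hl n : - (e n - e n.+1) <= u n.+1 - u n <= e n - e n.+1.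
  by rewrite -ler_norml; apply: le_trans (h n) _; rewrite /e exprS; lra.
pose a n := u n - e n; pose b n := u n + e n.
have nda : nondecreasing_seq a.
  by apply/nondecreasing_seqP => n; rewrite /a; have /andP[] := hl n; lra.
have nib : nonincreasing_seq b.
  by apply/nonincreasing_seqP => n; rewrite /b; have /andP[] := hl n; lra.
have ab m n : a m <= b n.
  apply: (@le_trans _ _ (a (maxn m n))); first exact/nda/leq_maxl.
  apply: (@le_trans _ _ (b (maxn m n))); last exact/nib/leq_maxr.
  by rewrite /a /b; have := e0 (maxn m n); lra.
have cva : cvgn a.
  apply: nondecreasing_is_cvgn => //; exists (b 0%N) => _ [m _ <-]; exact: ab.
have cve : e @ \oo --> (0 : R).
  apply: cvg_geometric; rewrite ger0_norm; lra.
have cvu : u @ \oo --> limn a.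
  rewrite -[limn a]addr0 (_ : u = a \+ e); first exact: cvgD.
  by apply/funext => n; rewrite /a /= subrK.
split; first by apply/cvg_ex; exists (limn a).
move=> n; rewrite (cvg_lim _ cvu) //.
have l1 : a n <= limn a by exact: nondecreasing_cvgn_le.
have l2 : limn a <= b n by apply: limr_le => //; apply: nearW => m; exact: ab.
by rewrite ler_norml; move: l1 l2; rewrite /a /b -/(e n); lra.
Qed.

(** * The gasket in barycentric coordinates *)

Section Gasket.
Context {R : realType}.
Implicit Types (p : R * R) (i j : 'I_3) (w : seq 'I_3) (V : @vfamily R).
Local Notation SG := (@SG R).
Local Notation q := (@q R).

Definition barycentric (i : 'I_3) p : R :=
  if i == o0 then p.2
  else if i == o1 then (1 - p.2 - Num.sqrt 3 * p.1) / 2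
  else (1 - p.2 + Num.sqrt 3 * p.1) / 2.

Let s3 : Num.sqrt 3 != 0 :> R.
Proof. by rewrite gt_eqF // sqrtr_gt0; lra. Qed.

Lemma barycentric_q i j : barycentric i (q j) = (i == j)%:R.
Proof.
elim/I3_ind: i; elim/I3_ind: j; rewrite /barycentric /Defs.q /=; try lra.
all: by rewrite ?mulrN ?mulfV //; lra.
Qed.

Lemma barycentric_sum p :
  barycentric o0 p + barycentric o1 p + barycentric o2 p = 1.
Proof. by rewrite /barycentric /=; lra. Qed.

Lemma barycentric_F i j p :
  barycentric i (F j p) = (barycentric i p + (i == j)%:R) / 2.
Proof.
rewrite -barycentric_q /F.
by elim/I3_ind: i; rewrite /barycentric /= /GRing.scale /=; lra.
Qed.

Lemma barycentric_inj p p' :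
  (forall i, barycentric i p = barycentric i p') -> p = p'.
Proof.
case: p p' => [a b] [c d] h; have := h o0; have := h o1.
rewrite /barycentric /= => h1 h0; congr pair => //.
by apply: (mulfI s3); lra.
Qed.

Lemma barycentric_continuous i : continuous (barycentric i).
Proof.
have c1 : continuous (fun p : R * R => p.1) by move=> p; exact: cvg_fst.
have c2 : continuous (fun p : R * R => p.2) by move=> p; exact: cvg_snd.
have c3 : continuous (fun p : R * R => 1 - p.2).
  by move=> p; apply: cvgB; [exact: cvg_cst | exact: c2].
have c4 : continuous (fun p : R * R => Num.sqrt 3 * p.1).
  by move=> p; apply: cvgM; [exact: cvg_cst | exact: c1].
elim/I3_ind: i => p; rewrite /barycentric /=.
- exact: c2.
- by apply: cvgM; [apply: cvgB; [exact: c3|exact: c4]|exact: cvg_cst].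
- by apply: cvgM; [apply: cvgD; [exact: c3|exact: c4]|exact: cvg_cst].
Qed.

Lemma SG_F i p : SG p -> SG (F i p).
Proof.
have [_ _ SGE] := @SG_attractor R.
by move=> h; rewrite SGE; exists i => //; exists p.
Qed.

Lemma SG_inv p : SG p -> exists i, exists2 p', SG p' & p = F i p'.
Proof.
have [_ _ SGE] := @SG_attractor R.
by rewrite {1}SGE => -[i _ [p' h <-]]; exists i, p'.
Qed.

(** A minimiser is some [F j m'], whose coordinate is at least half that of [m'], hence at least
    half the minimum; so the minimum is nonnegative. *)
Lemma barycentric_ge0 i p : SG p -> 0 <= barycentric i p.
Proof.
have [c ne _] := @SG_attractor R.
have [|m /set_mem Sm minm] := @compact_EVT_min _ _ (barycentric i) SG ne c.
  by apply: continuous_subspaceT; exact: barycentric_continuous.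
move=> Sp; apply: le_trans (minm _ (mem_set Sp)).
have [j [m' Sm' mE]] := SG_inv Sm.
have := minm _ (mem_set Sm'); rewrite mE barycentric_F.
by case: (i == j) => /=; lra.
Qed.

Lemma barycentric_le1 i p : SG p -> barycentric i p <= 1.
Proof.
move=> Sp; rewrite -(barycentric_sum p).
have := barycentric_ge0 o0 Sp; have := barycentric_ge0 o1 Sp.
have := barycentric_ge0 o2 Sp.
by elim/I3_ind: i; lra.
Qed.

(** A maximiser [m] of the [i]-th coordinate, with value [t], satisfies [(t + 1) / 2 <= t] by
    comparison with [F i m]; so [t = 1] and [m] is the corner. *)
Lemma SG_q i : SG (q i).
Proof.
have [c ne _] := @SG_attractor R.
have [|m /set_mem Sm maxm] := @compact_EVT_max _ _ (barycentric i) SG ne c.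
  by apply: continuous_subspaceT; exact: barycentric_continuous.
have := maxm _ (mem_set (SG_F i Sm)); rewrite barycentric_F eqxx /= => h.
suff -> : q i = m by [].
apply: barycentric_inj => j; rewrite barycentric_q; apply/esym.
have := barycentric_ge0 o0 Sm; have := barycentric_ge0 o1 Sm.
have := barycentric_ge0 o2 Sm; have := barycentric_sum m.
by move: h; elim/I3_ind: i {maxm}; elim/I3_ind: j => /=; lra.
Qed.

Lemma SG_F_word w p : SG p -> SG (F_word w p).
Proof. by elim: w => //= i w IH /IH; exact: SG_F. Qed.

Lemma SG_address n p : SG p ->
  exists w p', [/\ size w = n, SG p' & p = F_word w p'].
Proof.
elim: n p => [|n IH] p Sp; first by exists [::], p.
have [i [p' Sp' ->]] := SG_inv Sp.
have [w [p'' [sw Sp'' ->]]] := IH _ Sp'.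
by exists (i :: w), p''; rewrite /= sw.
Qed.

Lemma F_qC i j : F i (q j) = F j (q i).
Proof. by rewrite /F addrC. Qed.

Lemma F_qK i : F i (q i) = q i.
Proof.
by rewrite /F scalerDr -scalerDl (_ : _ + _ = 1) ?scale1r //; lra.
Qed.

Lemma F_word_rcons w i p : F_word (rcons w i) p = F_word w (F i p).
Proof. by rewrite /F_word foldr_rcons. Qed.

Lemma F_word_cat w w' p : F_word (w ++ w') p = F_word w (F_word w' p).
Proof. exact: foldr_cat. Qed.

Lemma F_word_nseq i m : F_word (nseq m i) (q i) = q i.
Proof. by elim: m => //= m ->; exact: F_qK. Qed.

Lemma F_word_sub w p p' :
  F_word w p - F_word w p' = (2 ^+ size w)^-1 *: (p - p').
Proof.
elim: w => [|i w IH] /=; first by rewrite expr0 invr1 scale1r.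
rewrite /F -scalerBr opprD addrACA subrr addr0 IH scalerA -invfM.
by rewrite -exprS.
Qed.

Definition Finv i p : R * R := 2 *: p - q i.

Lemma FK i : cancel (F i) (Finv i).
Proof.
by move=> p; rewrite /F /Finv scalerA divff ?pnatr_eq0 // scale1r addrK.
Qed.

Lemma Finv_continuous i : continuous (Finv i).
Proof.
move=> p; apply: (@cvgB R (R * R)%type); last exact: cvg_cst.
exact: (@scaler_continuous R (R * R)%type).
Qed.

Definition samples (u : R * R -> R) : @vfamily R :=
  fun w j => u (F_word w (q j)).

Lemma samples_compatible u : compatible (samples u).
Proof. by move=> w i j; rewrite /samples !F_word_rcons F_qC F_qK. Qed.

(** * Piecewise affine interpolation of vertex values *)

Definition branch p : 'I_3 :=
  if 1 / 2 <= barycentric o0 p then o0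
  else if 1 / 2 <= barycentric o1 p then o1 else o2.

Fixpoint interpolant n V p : R :=
  if n is m.+1 then
    interpolant m (V \o cons (branch p)) (Finv (branch p) p)
  else \sum_i barycentric i p * V [::] i.

Lemma interpolant_q n V i : compatible V -> interpolant n V (q i) = V [::] i.
Proof.
elim: n V i => [|n IH] V i cV /=.
  rewrite sum_I3 !barycentric_q.
  by elim/I3_ind: i => /=; rewrite ?mul1r ?mul0r ?addr0 ?add0r.
have -> : branch (q i) = i.
  have h0 : (1 / 2 <= 0 :> R) = false by apply/negbTE; rewrite -ltNge; lra.
  have h1 : 1 / 2 <= 1 :> R by lra.
  by rewrite /branch !barycentric_q; elim/I3_ind: (i) => /=; rewrite ?h0 ?h1.
rewrite -[X in Finv _ X]F_qK FK IH; last exact: compatible_cons.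
by case: (cV [::] i i).
Qed.

(** Where [branch] picks another subcell than [i], the point is the common vertex of the two, and
    compatibility makes both readings agree. *)
Lemma interpolant_F n V i p : compatible V -> SG p ->
  interpolant n.+1 V (F i p) = interpolant n (V \o cons i) p.
Proof.
move=> cV Sp /=; have [->|ji] := eqVneq (branch (F i p)) i; first by rewrite FK.
set j := branch (F i p) in ji *.
have hj : 1 / 2 <= barycentric j (F i p).
  move: ji; rewrite /j /branch; case: ifP => // h0; case: ifP => // h1.
  have := barycentric_sum (F i p).
  have := barycentric_ge0 o0 Sp; have := barycentric_ge0 o1 Sp.
  have := barycentric_ge0 o2 Sp.
  move: h0 h1 => /negbT + /negbT; rewrite -!ltNge !barycentric_F.
  by elim/I3_ind: i {j} => //=; lra.
have pE : p = q j.
  apply: barycentric_inj => k; rewrite barycentric_q.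
  move: hj; rewrite barycentric_F (negPf ji).
  have := barycentric_ge0 o0 Sp; have := barycentric_ge0 o1 Sp.
  have := barycentric_ge0 o2 Sp; have := barycentric_sum p.
  by elim/I3_ind: (j); elim/I3_ind: k => /=; lra.
rewrite pE F_qC FK !interpolant_q; try exact: compatible_cons.
by case: (cV [::] i j).
Qed.

End Gasket.

(** * Continuous functions from vertex values *)

Section Glue.
Context {R : realType}.
Implicit Types (p : R * R) (i j : 'I_3) (w : seq 'I_3) (V : @vfamily R).
Local Notation SG := (@SG R).
Local Notation q := (@q R).

Lemma F_continuous i : continuous (@F R i).
Proof.
move=> p; apply: (@cvg_comp _ _ _ (fun p => p + q i) (fun p => 2^-1 *: p)).
  by apply: (@cvgD R (R * R)%type); [exact: cvg_id | exact: cvg_cst].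
exact: (@scaler_continuous R (R * R)%type).
Qed.

Lemma F_SG_closed i : closed (F i @` SG).
Proof.
apply: (compact_closed (@norm_hausdorff R (R * R)%type)).
have [c _ _] := @SG_attractor R; apply: continuous_compact => //.
exact/continuous_subspaceT/F_continuous.
Qed.

(** Pasting along the closed cover of the gasket by its three subcells, on each of which
    [interpolant_F] lowers the level. *)
Lemma interpolant_continuous n V :
  compatible V -> {within SG, continuous (interpolant n V)}.
Proof.
elim: n V => [|n IH] V cV.
  apply: continuous_subspaceT => p; rewrite /interpolant.
  have c i : (fun p => barycentric i p * V [::] i) @ p -->
      barycentric i p * V [::] i.
    by apply: cvgM; [exact: barycentric_continuous | exact: cvg_cst].
  rewrite /continuous_at sum_I3; under eq_fun do rewrite sum_I3.
  by apply: cvgD; first apply: cvgD; exact: c.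
have cont i : {within F i @` SG, continuous (interpolant n.+1 V)}.
  apply: (@subspace_eq_continuous _ _ _
    (fun p => interpolant n (V \o cons i) (Finv i p))).
    move=> p /set_mem[p' Sp' <-]; rewrite /from_subspace FK.
    exact/esym/interpolant_F.
  apply/subspace_continuousP => _ [p' Sp' <-]; rewrite FK.
  have /subspace_continuousP/(_ p' Sp') h := IH _ (compatible_cons i cV).
  move=> W Wp; have nW : \forall y \near p', SG y ->
    W (interpolant n (V \o cons i) y) by exact: h Wp.
  change (\forall y \near F i p', (F i @` SG) y ->
    W (interpolant n (V \o cons i) (Finv i y))).
  have cF : Finv i y @[y --> F i p'] --> p'.
    by have := @Finv_continuous R i (F i p'); rewrite /continuous_at FK.
  apply: (@filterS _ (nbhs (F i p')) _ _ _ _ (cF _ nW)) => y /= Wy.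
  move=> [p'' Sp'' pE]; apply: Wy.
  by rewrite -pE FK.
rewrite (_ : SG = (F o0 @` SG `|` F o1 @` SG) `|` F o2 @` SG).
  have cl := F_SG_closed.
  apply: withinU_continuous => //; first exact: closedU.
  exact: withinU_continuous.
apply/seteqP; split=> p.
  move=> /SG_inv[i [p' Sp' ->]].
  by elim/I3_ind: i; [left; left|left; right|right]; exists p'.
by move=> [[|]|] [p' Sp' <-]; exact: SG_F.
Qed.

Definition tame C V :=
  forall w i j, `|V w i - V w j| <= C * (4 / 5) ^+ size w.

Lemma tame_cons C V i : tame C V -> tame (4 / 5 * C) (V \o cons i).
Proof.
by move=> h w j k; have := h (i :: w) j k; rewrite /= exprS mulrA [C * _]mulrC.
Qed.

(** Squared differences at level [n] are at most [M (3/5)^n]; the rational rate 4/5 exceeds the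
    square root of 3/5, and [M + 1] that of [M]. *)
Lemma level_energy_tame M V :
  (forall n, level_energy V n <= M) -> tame (M + 1) V.
Proof.
move=> h w i j.
have M0 : 0 <= M by apply: le_trans (h 0%N); exact: level_energy_ge0.
have e0 : 0 <= (M + 1) * (4 / 5) ^+ size w.
  by rewrite mulr_ge0 ?exprn_ge0 //; lra.
rewrite -[leRHS]ger0_norm // -ler_sqr ?nnegrE ?normr_ge0 // !real_normK ?num_real //.
have := le_trans (level_energy_ge V w) (h (size w)).
set n := size w => h1.
have p53 : 0 < (5 / 3) ^+ n :> R by rewrite exprn_gt0 //; lra.
rewrite -(ler_pM2l p53).
have h2 : (5 / 3) ^+ n * (V w i - V w j) ^+ 2 <= M.
  by apply: le_trans h1; rewrite ler_pM2l // edge_energy_ge.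
apply: (le_trans h2).
have h3 : 1 <= (5 / 3) ^+ n * ((4 / 5) ^+ n) ^+ 2 :> R.
  by rewrite exprAC -exprMn exprn_ege1 //; lra.
move: {p53 h1 h2 e0}((5 / 3) ^+ n) ((4 / 5) ^+ n) h3 => a b h3.
rewrite (_ : _ * _ = (M + 1) ^+ 2 * (a * b ^+ 2)); last by ring.
apply: le_trans (ler_wpM2l (sqr_ge0 _) h3).
by rewrite mulr1; nra.
Qed.

Lemma barycentric_comb C V p k : SG p ->
  (forall i j, `|V [::] i - V [::] j| <= C) ->
  `|\sum_i barycentric i p * V [::] i - V [::] k| <= C.
Proof.
move=> Sp h.
have -> : \sum_i barycentric i p * V [::] i - V [::] k =
    \sum_i barycentric i p * (V [::] i - V [::] k).
  by rewrite !sum_I3; have := barycentric_sum p => s; nra.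
apply: le_trans (ler_norm_sum _ _ _) _.
rewrite -[leRHS]mul1r -(barycentric_sum p) -(sum_I3 (barycentric^~ p)) mulr_suml.
apply: ler_sum => i _; rewrite normrM ger0_norm ?barycentric_ge0 //.
by rewrite ler_wpM2l ?barycentric_ge0.
Qed.

Lemma interpolant_increment C n V p : compatible V -> tame C V -> SG p ->
  `|interpolant n.+1 V p - interpolant n V p| <= 2 * C * (4 / 5) ^+ n.
Proof.
elim: n C V p => [|n IH] C V p cV tV Sp; have [i [p' Sp' pE]] := SG_inv Sp.
  rewrite pE interpolant_F // -pE /= expr0 mulr1.
  (* Both interpolants are compared with the value at the corner [q i], shared by the cell and its
     subcell: [C + 4/5 C <= 2 C]. *)
  have h1 := @barycentric_comb C V p i Sp.
  have h2 := @barycentric_comb (4 / 5 * C) (V \o cons i) p' i Sp'.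
  have e : (V \o cons i) [::] i = V [::] i by case: (cV [::] i i).
  rewrite e in h2.
  have C0 : 0 <= C.
    by have := le_trans (normr_ge0 _) (tV [::] o0 o0); rewrite /= expr0 mulr1.
  have {}h1 : `|\sum_j barycentric j p * V [::] j - V [::] i| <= C.
    by apply: h1 => j k; have := tV [::] j k; rewrite /= expr0 mulr1.
  have {}h2 : `|\sum_j barycentric j p' * (V \o cons i) [::] j - V [::] i|
      <= 4 / 5 * C.
    apply: h2 => j k; have := tame_cons i tV [::] j k.
    by rewrite [size _]/= expr0 mulr1.
  move: h1 h2; rewrite !ler_norml; lra.
rewrite pE !interpolant_F //.
apply: le_trans (IH _ _ _ (compatible_cons i cV) (tame_cons i tV) Sp') _.
by rewrite exprS; lra.
Qed.

Definition glue V p : R := limn (fun n => interpolant n V p).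

Lemma glue_cvg C V p : compatible V -> tame C V -> SG p ->
  cvgn (fun n => interpolant n V p) /\
  forall n, `|glue V p - interpolant n V p| <= 10 * C * (4 / 5) ^+ n.
Proof.
move=> cV tV Sp; apply: geometric_increments_cvg => n.
exact: interpolant_increment.
Qed.

Lemma glue_continuous C V : compatible V -> tame C V ->
  {within SG, continuous (glue V)}.
Proof.
move=> cV tV.
apply: (@uniform_limit_continuous_subspace _ _ _
  ((fun n => interpolant n V) @ \oo) (glue V)).
  near_simpl; apply: nearW => n; exact: interpolant_continuous.
move=> P /uniform_nbhs[E [entE EP]].
move: entE; rewrite -entourage_ballE => -[e /= e0 eE].
have : (fun n => 10 * C * (4 / 5) ^+ n) @ \oo --> (0 : R).
  by apply: cvg_geometric; rewrite ger0_norm; lra.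
move=> /cvgrPdist_lt/(_ e e0); apply: filterS => n hn; apply: EP => p Sp.
apply: eE; rewrite /= -ball_normE /=.
apply: le_lt_trans ((glue_cvg cV tV Sp).2 n) _.
by apply: le_lt_trans (ler_norm _) _; rewrite -normrN -sub0r.
Qed.

Lemma interpolant_F_word V w n p : compatible V -> SG p ->
  interpolant (size w + n) V (F_word w p) =
  interpolant n (fun w' => V (w ++ w')) p.
Proof.
elim: w V => [|i w IH] V cV Sp; first by [].
rewrite [size _]/= [F_word _ _]/= addSn interpolant_F //; last exact: SG_F_word.
exact: (IH _ (compatible_cons i cV) Sp).
Qed.

(** From level [size w] on, the interpolants are constant in the level at this vertex. *)
Lemma glueE C V w i : compatible V -> tame C V ->
  glue V (F_word w (q i)) = V w i.
Proof.
move=> cV tV; rewrite /glue; apply: cvg_lim => //.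
rewrite -(cvg_shiftn (size w)) /=.
have cV' : compatible (fun w' => V (w ++ w')).
  by elim: w V cV {tV} => //= k w IH V cV; exact: IH (compatible_cons k cV).
rewrite (_ : (fun n => _) = fun=> V w i); first exact: cvg_cst.
apply/funext => n; rewrite addnC interpolant_F_word //; last exact: SG_q.
by rewrite interpolant_q // cats0.
Qed.

Lemma eq_glue U V p : (forall w j, U w j = V w j) -> glue U p = glue V p.
Proof.
by move=> UV; congr glue; apply/funext => w; apply/funext => j.
Qed.

Lemma interpolant_linear a U V n p :
  interpolant n (fun w j => a * U w j + V w j) p =
  a * interpolant n U p + interpolant n V p.
Proof.
elim: n U V p => [|n IH] U V p /=; first by rewrite !sum_I3; ring.
exact: (IH (U \o cons (branch p)) (V \o cons (branch p))).
Qed.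

Lemma glue_linear a C D U V p : compatible U -> tame C U ->
  compatible V -> tame D V -> SG p ->
  glue (fun w j => a * U w j + V w j) p = a * glue U p + glue V p.
Proof.
move=> cU tU cV tV Sp; apply: cvg_lim => //.
under eq_fun do rewrite interpolant_linear.
apply: cvgD; last by case: (glue_cvg cV tV Sp).
by apply: cvgM; [exact: cvg_cst|case: (glue_cvg cU tU Sp)].
Qed.

End Glue.

(** * Energies of functions and the position of cells relative to the line *)

Section Energies.
Context {R : realType}.
Implicit Types (p : R * R) (i j : 'I_3) (w : seq 'I_3) (V : @vfamily R).
Local Notation SG := (@SG R).
Local Notation q := (@q R).

Lemma sum_tuple0 (f : seq 'I_3 -> R) : \sum_(w : 0.-tuple 'I_3) f w = f [::].
Proof.
by rewrite (big_pred1 [tuple]) // => t; rewrite [t]tuple0; apply/esym/eqP.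
Qed.

Lemma sum_tupleS (f : seq 'I_3 -> R) n :
  \sum_(w : n.+1.-tuple 'I_3) f w = \sum_i \sum_(w : n.-tuple 'I_3) f (i :: w).
Proof.
rewrite pair_bigA /=.
rewrite (reindex (fun p : 'I_3 * n.-tuple 'I_3 => cons_tuple p.1 p.2)) //=.
exists (fun t => (thead t, behead_tuple t)) => [[i w]|t] _ /=.
  by rewrite theadE; congr pair; exact: val_inj.
by rewrite [RHS]tuple_eta; exact: val_inj.
Qed.

Lemma level_energyE V n : level_energy V n =
  (5 / 3) ^+ n * \sum_(w : n.-tuple 'I_3) edge_energy (V w).
Proof.
elim: n V => [|n IH] V; first by rewrite mul1r (sum_tuple0 (edge_energy \o V)).
rewrite /= (sum_tupleS (edge_energy \o V)) exprS -[RHS]mulrA; congr (_ * _).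
by rewrite mulr_sumr; apply: eq_bigr => i _; exact: IH.
Qed.

Lemma above_energyE b V n : above_energy b V n =
  (5 / 3) ^+ n * \sum_(w : n.-tuple 'I_3 | above_word b w) edge_energy (V w).
Proof.
pose f b V w := if above_word b w then edge_energy (V w) else 0.
rewrite big_mkcond -[bigop _ _ _]/(\sum_(w : n.-tuple 'I_3) f b V w).
elim: n b V => [|n IH] b V; first by rewrite sum_tuple0 mulr0.
rewrite /= sum_tupleS exprS -[RHS]mulrA; congr (_ * _); rewrite sum_I3.
have fE i c : (forall w, above_word b (i :: w) = above_word c w) ->
    \sum_(w : n.-tuple 'I_3) f b V (i :: w) =
    \sum_(w : n.-tuple 'I_3) f c (V \o cons i) w.
  by move=> e; apply: eq_bigr => w _; rewrite /f e.
have f0 i : (forall w, above_word b (i :: w) = false) ->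
    \sum_(w : n.-tuple 'I_3) f b V (i :: w) = 0.
  by move=> e; rewrite big1 // => w _; rewrite /f e.
case b0: (b 0%N) => /=.
- rewrite level_energyE !IH -!mulrDr addrA; congr (_ * (_ + _ + _)).
  + by apply: eq_bigr => w _; rewrite /f /= b0.
  + by apply/esym/fE => w /=; rewrite b0.
  + by apply/esym/fE => w /=; rewrite b0.
- rewrite (fE o0 (shift b)); last by move=> w /=; rewrite b0.
  rewrite (f0 o1); last by move=> w /=; rewrite b0.
  by rewrite (f0 o2) ?addr0 ?IH // => w /=; rewrite b0.
Qed.

Lemma cell_energyE (u : R * R -> R) w :
  cell_energy u w = edge_energy (samples u w).
Proof.
rewrite /cell_energy sum_I3.
do 3 rewrite [\sum_(j < 3 | _) _]big_mkcond sum_I3 /=.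
by rewrite !addr0 !add0r.
Qed.

(** Samples of a function are compatible, so the levels are monotone and the limit is a supremum. *)
Lemma energyE (u : R * R -> R) :
  energy u = ereal_sup (range (fun n => (level_energy (samples u) n)%:E)).
Proof.
rewrite /energy.
under eq_fun do under eq_bigr do rewrite cell_energyE.
under eq_fun do rewrite -level_energyE.
apply/cvg_lim => //; apply: ereal_nondecreasing_cvgn => m n mn.
rewrite lee_fin; apply: level_energy_nondecreasing => //.
exact: samples_compatible.
Qed.

Lemma level_energy_le_energy (u : R * R -> R) n :
  ((level_energy (samples u) n)%:E <= energy u)%E.
Proof. by rewrite energyE; apply: ereal_sup_ubound; exists n. Qed.

Lemma energy_le (u : R * R -> R) (M : R) :
  (forall n, level_energy (samples u) n <= M) -> (energy u <= M%:E)%E.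
Proof.
move=> h; rewrite energyE; apply: ge_ereal_sup => _ [n _ <-].
by rewrite lee_fin.
Qed.

(** The orbit of [x] under doubling: [y k] is the relative depth of [L_x] in a crossed [k]-cell. The
    strict bounds keep the line away from all vertices. *)
Definition digits (x : R) (b : nat -> bool) :=
  exists y : nat -> R, [/\ y 0%N = x, forall k, 0 < y k < 1 &
    forall k, y k.+1 = 2 * y k - (b k)%:R].

Lemma digits_shift x b : digits x b -> digits (2 * x - (b 0%N)%:R) (shift b).
Proof. by move=> [y [y0 yi ys]]; exists (fun k => y k.+1); rewrite ys y0. Qed.

Lemma digits_itv x b : digits x b -> 0 < x < 1.
Proof. by move=> [y [<- yi _]]. Qed.

Lemma F_height i p : (F i p).2 = (p.2 + (i == o0)%:R) / 2.
Proof. by have := barycentric_F o0 i p; rewrite /barycentric /= eq_sym. Qed.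

Lemma SG_height p : SG p -> 0 <= p.2 <= 1.
Proof.
move=> Sp; have := barycentric_ge0 o0 Sp; have := barycentric_le1 o0 Sp.
by rewrite /barycentric /= => -> ->.
Qed.

(** Self-similarity: a crossed third sees the line at depth [2 * x - b 0], and any other third lies
    on one side of it. *)
Lemma bottom_above x b w : digits x b ->
  (1 - x < (F_word w (q o1)).2) = above_word b w.
Proof.
elim: w x b => [|i w IH] x b dx.
  by apply/negbTE; rewrite -leNgt /= ; have := digits_itv dx; lra.
rewrite -[F_word (_ :: _) _]/(F i (F_word w _)) F_height.
have /digits_itv := digits_shift dx; rewrite [above_word _ _]/= -(IH _ _ (digits_shift dx)).
have := SG_height (SG_F_word w (SG_q o1)).
move: (F_word w _).2 => h; case: (b 0%N); case: (i == o0) => /=;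
  move=> /andP[h0 h1] /andP[x0 x1].
- by apply/idP; lra.
- by apply/idP/idP; lra.
- by apply/idP/idP; lra.
- by apply/negbTE; rewrite -leNgt; lra.
Qed.

Lemma top_above x b w : digits x b ->
  (1 - x < (F_word w (q o0)).2) = above_word b w || crossing_word b w.
Proof.
elim: w x b => [|i w IH] x b dx.
  by rewrite /=; have := digits_itv dx; lra.
rewrite -[F_word (_ :: _) _]/(F i (F_word w _)) F_height.
rewrite [above_word _ _]/= [crossing_word _ _]/=.
have /digits_itv := digits_shift dx; have := IH _ _ (digits_shift dx).
have := SG_height (SG_F_word w (SG_q o0)).
move: (F_word w _).2 => h; case: (b 0%N); case: (i == o0) => /=;
  move=> /andP[h0 h1] E /andP[x0 x1].
- by apply/idP; lra.
- by rewrite -E; apply/idP/idP; lra.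
- by rewrite -E; apply/idP/idP; lra.
- by apply/negbTE; rewrite -leNgt; lra.
Qed.

Lemma cell_above x b w : digits x b ->
  `[< cell w `<=` above x >] = above_word b w.
Proof.
move=> dx; rewrite -(bottom_above w dx); apply/asboolP/idP => h.
  suff [] : above x (F_word w (q o1)) by [].
  by apply: h; exists (q o1) => //; exact: SG_q.
move=> _ [p Sp <-]; split; first exact: SG_F_word.
apply: (lt_le_trans h).
have := congr1 snd (F_word_sub w p (q o1)); rewrite /= /GRing.scale /= subr0.
have /andP[p0 _] := SG_height Sp.
have : 0 <= (2 ^+ size w)^-1 * p.2 by rewrite mulr_ge0 // invr_ge0 exprn_ge0.
by lra.
Qed.

End Energies.

(** * From the expansion of [x] to its digits *)

Section Digits.
Context {R : realType}.

(** Digits are indexed from 0, exponents from 1, hence [k.+1]. *)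
Definition digits_of (n : nat -> nat) : nat -> bool :=
  fun k => `[< exists m, n m = k.+1 >].

Lemma increasing_lt (n : nat -> nat) : (0 < n 0)%N ->
  {homo n : i j / (i < j)%N} -> forall m, (m < n m)%N.
Proof. by move=> n0 nn; elim=> // m /leq_ltn_trans; apply; exact: nn. Qed.

Lemma increasing_le (n : nat -> nat) :
  {homo n : i j / (i < j)%N} -> {homo n : i j / (i <= j)%N}.
Proof.
by move=> nn i j; rewrite leq_eqVlt => /predU1P[->//|/nn/ltnW].
Qed.

Section Expansion.
Variables (x : R) (n : nat -> nat).
Hypotheses (x_ndyadic : ~ dyadic x) (hx : binary_expansion x n).

Let n0 : (0 < n 0)%N. Proof. by case: hx. Qed.
Let nlt : {homo n : i j / (i < j)%N}. Proof. by case: hx. Qed.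
Let b := digits_of n.
Let S k : R := \sum_(j < k) (b j)%:R / 2 ^+ j.+1.
Let s := series (fun k => (2 ^+ n k)^-1 : R).

Let S_step k : S k.+1 = S k + (b k)%:R / 2 ^+ k.+1.
Proof. by rewrite /S big_ord_recr. Qed.

Let S_nd : {homo S : i j / (i <= j)%N >-> i <= j}.
Proof.
by apply/nondecreasing_seqP => k; rewrite S_step lerDl divr_ge0 // exprn_ge0.
Qed.

Let gap m j : (n m <= j)%N -> (j.+1 < n m.+1)%N -> b j = false.
Proof.
move=> mj jm; apply/asboolP => -[i ni].
case: (leqP i m) => im; have := increasing_le nlt im; lia.
Qed.

(** The index [(n m).-1] keeps the exponents below [n m], which are the first [m]; [S] is flat
    between consecutive exponents. *)
Let S_series m : S (n m).-1 = s m.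
Proof.
elim: m => [|m IH].
  rewrite /s /series /= big_geq // /S big1 // => j _.
  rewrite (_ : b j = false) ?mul0r //; apply/asboolP => -[i ni].
  by have := increasing_le nlt (leq0n i); have := ltn_ord j; lia.
have nm0 : (0 < n m)%N by apply: leq_ltn_trans (increasing_lt n0 nlt m).
have flat d : (n m + d <= (n m.+1).-1)%N -> S (n m + d)%N = S (n m).
  elim: d => [|d IHd] h; first by rewrite addn0.
  rewrite addnS S_step IHd; last by lia.
  by rewrite (@gap m) ?mul0r ?addr0 //; lia.
have nm := nlt (ltnSn m).
have -> : (n m.+1).-1 = (n m + ((n m.+1).-1 - n m))%N by lia.
rewrite flat; last by lia.
rewrite -{1}(prednK nm0) S_step IH prednK // /s !seriesEnat /=.
rewrite (_ : b (n m).-1 = true) ?mul1r; last first.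
  by apply/asboolP; exists m; rewrite prednK.
by rewrite big_nat_recr.
Qed.

Let s_nd : nondecreasing_seq s.
Proof.
by apply/nondecreasing_seqP => k; rewrite /s seriesSr lerDl invr_ge0 exprn_ge0.
Qed.

Let s_cvg : s @ \oo --> x. Proof. by case: hx. Qed.

Let s_le m : s m <= x.
Proof.
rewrite -(cvg_lim _ s_cvg) //; apply: nondecreasing_cvgn_le => //.
by apply/cvg_ex; exists x.
Qed.

Let S_lt k : S k < x.
Proof.
apply: (@le_lt_trans _ _ (S (n k).-1)).
  by apply: S_nd; have := increasing_lt n0 nlt k; lia.
rewrite S_series; apply: lt_le_trans (s_le k.+1).
by rewrite /s seriesSr ltrDl invr_gt0 exprn_gt0.
Qed.

Let S_tail k d : S (k + d) <= S k + 2 ^- k - 2 ^- (k + d).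
Proof.
elim: d => [|d IH]; first by rewrite addn0; lra.
rewrite addnS S_step.
have e : 2 ^- (k + d) = 2 * 2 ^- (k + d).+1 :> R.
  by rewrite [in RHS]exprS invfM mulrA divff ?mul1r.
have g0 : 0 <= 2 ^- (k + d).+1 :> R by rewrite invr_ge0 exprn_ge0.
by move: IH; rewrite e; case: (b _) => /=; lra.
Qed.

Let S_ge k : x <= S k + 2 ^- k.
Proof.
have h j : S j <= S k + 2 ^- k.
  have g0 i : 0 <= 2 ^- i :> R by rewrite invr_ge0 exprn_ge0.
  case: (leqP k j) => [/subnKC <-|/ltnW/S_nd].
    by have := S_tail k (j - k); have := g0 (k + (j - k))%N; lra.
  by have := g0 k; lra.
rewrite -(cvg_lim _ s_cvg) //; apply: limr_le.
  by apply/cvg_ex; exists x.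
by apply: nearW => m; rewrite -S_series.
Qed.

Let S_dyadic k : exists z : int, S k = z%:~R / 2 ^+ k.
Proof.
elim: k => [|k [z IH]]; first by exists 0; rewrite /S big_ord0 mul0r.
exists (2 * z + (b k)%:Z); rewrite S_step IH intrD intrM exprS.
have : 2 ^+ k != 0 :> R by rewrite expf_neq0.
by case: (b k) => /= ? ; field.
Qed.

(** The scaled remainder [2 ^+ k * (x - S k)] is the doubling orbit: positive because the expansion
    is infinite, below 1 because equality would make [x] dyadic. *)
Lemma binary_expansion_digits : digits x (digits_of n).
Proof.
exists (fun k => 2 ^+ k * (x - S k)); split.
- by rewrite /S big_ord0 subr0 mul1r.
- move=> k; have p0 : 0 < 2 ^+ k :> R by rewrite exprn_gt0.
  rewrite mulr_gt0 ?subr_gt0 //= mulrC -ltr_pdivlMr // mul1r ltrBlDl.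
  rewrite lt_neqAle S_ge andbT; apply/eqP => xE; apply: x_ndyadic.
  have [z zE] := S_dyadic k; exists (z + 1), k.
  by rewrite xE zE intrD mulrDl mul1r.
- move=> k; rewrite S_step exprS.
  have : 2 ^+ k != 0 :> R by rewrite expf_neq0.
  by rewrite -/b; case: (b k) => /= ?; field.
Qed.

End Expansion.

Lemma nonconsecutive_runs n N : nonconsecutive n N ->
  (0 < N)%N /\ forall k, exists2 r, (r <= N.-1)%N & ~~ digits_of n (k + r)%N.
Proof.
(* The empty run always exists, so [N = 0] contradicts the hypothesis. *)
move=> h; have N0 : (0 < N)%N.
  by case: N h => // h; exfalso; apply: h; exists 0%N.
split=> // k; apply: contrapT => run; apply: h; exists k.+1 => j jN.
apply: contrapT => nm; apply: run; exists j; first by lia.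
by apply/asboolP => -[m mE]; apply: nm; exists m; rewrite mE addSn.
Qed.

Lemma digits_drop (x : R) b k : digits x b ->
  exists y : R, digits y (fun j => b (k + j)%N).
Proof.
move=> [y [y0 yi ys]]; exists (y k), (fun j => y (k + j)%N).
by split => [|j|j]; rewrite ?addn0 ?addnS.
Qed.

(** If all digits were 1, the distance [1 - y j] would double at each step and leave the unit
    interval. *)
Lemma digits_zero (x : R) b : digits x b -> exists r, ~~ b r.
Proof.
move=> [y [y0 yi ys]]; apply: contrapT => h.
have b1 r : b r by apply: contrapT => br; apply: h; exists r; exact/negP.
have yE j : 1 - y j = 2 ^+ j * (1 - y 0%N).
  elim: j => [|j IH]; first by rewrite mul1r.
  by rewrite ys b1 /= exprS -mulrA -IH; ring.
have e0 : 0 < 1 - y 0%N by have := yi 0%N; lra.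
have := archi_boundP (ltW (divr_gt0 ltr01 e0)).
set j := Num.bound _ => hj.
have : (1 - y 0%N)^-1 < 2 ^+ j.
  rewrite -[_^-1]mul1r; apply: lt_trans hj _.
  by rewrite -natrX ltr_nat ltn_expl.
rewrite -[2 ^+ j](mulfK (lt0r_neq0 e0)) -yE -[X in X < _]mul1r ltr_pM2r ?invr_gt0 //.
by have := yi j; lra.
Qed.

End Digits.

(** * The extension operator on functions *)

Section Extension.
Context {R : realType}.
Implicit Types (u v : R * R -> R) (p : R * R) (w : seq 'I_3) (x : R).
Local Notation SG := (@SG R).
Local Notation q := (@q R).

Lemma SG_vertex_approx p : SG p ->
  exists w : nat -> seq 'I_3, F_word (w k) (q o0) @[k --> \oo] --> p.
Proof.
move=> Sp.
have /choice[w wP] k := SG_address k Sp.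
exists w.
have [c _ _] := @SG_attractor R; have [M [_ hM]] := compact_bounded c.
have SM p' : SG p' -> `|p'| <= `|M| + 1.
  by apply: hM; apply: le_lt_trans (ler_norm _) _; rewrite ltrDl.
apply/cvgrPdist_lt => e e0.
have : (fun k => (2 * (`|M| + 1)) * (2^-1) ^+ k) @ \oo --> (0 : R).
  by apply: cvg_geometric; rewrite ger0_norm; lra.
move=> /cvgrPdist_lt/(_ e e0); apply: filterS => k.
have [p' [sw Sp' {1}->]] := wP k.
rewrite sub0r normrN F_word_sub sw exprVn => h.
have g0 : 0 <= 2 ^- k :> R by rewrite invr_ge0 exprn_ge0.
apply: le_lt_trans h; apply: le_trans (ler_norm _).
rewrite normrZ (ger0_norm g0) mulrC ler_wpM2r //.
apply: le_trans (ler_normB _ _) _.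
by have := SM _ Sp'; have := SM _ (SG_q o0); lra.
Qed.

Lemma within_cvg_seq (A : set (R * R)) u p (s : nat -> R * R) :
  {within A, continuous u} -> A p -> (\forall k \near \oo, A (s k)) ->
  s @ \oo --> p -> u (s k) @[k --> \oo] --> u p.
Proof.
move=> /subspace_continuousP cu Ap As sp W Wp.
have nW : \forall y \near p, A y -> W (u y) by exact: (cu p Ap W Wp).
have : \forall k \near \oo, A (s k) -> W (u (s k)) by exact: (sp _ nW).
by move: As; apply: filterS2 => k Ak; apply.
Qed.

(** Density: tops of small cells around a point strictly above the line are above it too, hence
    belong to cells that are above or crossed. *)
Lemma eq_on_above x b u v : digits x b ->
  {within above x, continuous u} -> {within above x, continuous v} ->
  (forall w, above_word b w || crossing_word b w ->
    u (F_word w (q o0)) = v (F_word w (q o0))) ->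
  forall p, above x p -> u p = v p.
Proof.
move=> dx cu cv uv p [Sp xp].
have [w wp] := SG_vertex_approx Sp.
have wx : \forall k \near \oo, 1 - x < (F_word (w k) (q o0)).2.
  have : (F_word (w k) (q o0)).2 @[k --> \oo] --> p.2.
    exact: (cvg_comp _ _ wp cvg_snd).
  by move=> /cvgr_gt; apply.
have wa : \forall k \near \oo, above x (F_word (w k) (q o0)).
  by apply: filterS wx => k h; split => //; exact/SG_F_word/SG_q.
have cu' := within_cvg_seq cu (conj Sp xp) wa wp.
have cv' := within_cvg_seq cv (conj Sp xp) wa wp.
apply: (cvg_unique _ cu') => //; apply: cvg_trans cv'.
apply: near_eq_cvg; apply: filterS wx => k.
by rewrite (top_above _ dx) => /uv.
Qed.

Section AboveEnergy.
Variables (x : R) (b : nat -> bool) (n : nat -> nat).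
Hypotheses (dx : digits x b) (n_gt0 : (0 < n 0)%N).
Hypothesis n_incr : {homo n : i j / (i < j)%N}.

Lemma energy_aboveE u : energy_above x n u =
  ereal_sup (range (fun m => (above_energy b (samples u) (n m))%:E)).
Proof.
rewrite /energy_above.
under eq_fun do under eq_bigr do rewrite cell_energyE.
under eq_fun do under eq_bigl do rewrite (cell_above _ dx).
under eq_fun do rewrite -above_energyE.
apply/cvg_lim => //; apply: ereal_nondecreasing_cvgn => i j ij.
rewrite lee_fin; apply: above_energy_nondecreasing.
  exact: samples_compatible.
exact: increasing_le.
Qed.

Lemma above_energy_le_energy_above u k :
  ((above_energy b (samples u) k)%:E <= energy_above x n u)%E.
Proof.
(* The energy is taken along the levels [n m] only; [k < n k] and monotonicity reach every level
   [k]. *)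
rewrite energy_aboveE; apply: (@le_trans _ _
  (above_energy b (samples u) (n k))%:E); last by apply: ereal_sup_ubound; exists k.
rewrite lee_fin above_energy_nondecreasing //; first exact: samples_compatible.
exact/ltnW/increasing_lt.
Qed.

Lemma energy_above_le u (M : R) :
  (forall k, above_energy b (samples u) k <= M) ->
  (energy_above x n u <= M%:E)%E.
Proof.
move=> h; rewrite energy_aboveE; apply: ge_ereal_sup => _ [m _ <-].
by rewrite lee_fin.
Qed.

Lemma dom_energy_above_fin u : dom_energy_above x n u ->
  exists2 E : R, 0 <= E & energy_above x n u = E%:E.
Proof.
move=> [_ fin]; have ge0 : (0 <= energy_above x n u)%E.
  apply: le_trans (above_energy_le_energy_above u 0).
  by rewrite lee_fin above_energy_ge0.
exists (fine (energy_above x n u)); first exact: fine_ge0.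
by rewrite fineK // ge0_fin_numE.
Qed.

(** Starting with [beta] equal to the value at [q o0] removes the [crossing_cost] term at the
    root. *)
Definition extend u : R * R -> R :=
  glue (extension b (u (q o0)) (samples u)).

Lemma extension_samples_compatible beta u :
  compatible (extension b beta (samples u)).
Proof. exact/extension_compatible/samples_compatible. Qed.

Variable L : nat.
Hypothesis runs : forall k, exists2 r, (r <= L)%N & ~~ b (k + r)%N.

Lemma level_energy_extend u k (E : R) : energy_above x n u = E%:E ->
  level_energy (extension b (u (q o0)) (samples u)) k <=
  (bound_cst L + 1) * E.
Proof.
move=> uE; have [r rL br] := runs 0%N.
have c := samples_compatible u.
apply: le_trans (level_energy_extension _ _ c (leqnn L) _ runs) _.
  by exists r.
rewrite subrr expr0n mulr0 addr0 ler_pM2l; last first.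
  by rewrite addr_gt0 // /bound_cst mulr_gt0 ?exprn_gt0 //; lra.
by rewrite -lee_fin -uE above_energy_le_energy_above.
Qed.

Lemma extension_tame u : dom_energy_above x n u ->
  exists C : R, tame C (extension b (u (q o0)) (samples u)).
Proof.
move=> /dom_energy_above_fin[E _ uE].
exists ((bound_cst L + 1) * E + 1); apply: level_energy_tame => k.
exact: level_energy_extend.
Qed.

Lemma extendE u w j : dom_energy_above x n u ->
  extend u (F_word w (q j)) = extension b (u (q o0)) (samples u) w j.
Proof.
move=> /extension_tame[C tC].
exact: (glueE _ _ (extension_samples_compatible _ _) tC).
Qed.

Lemma extend_continuous u : dom_energy_above x n u ->
  {within SG, continuous (extend u)}.
Proof.
move=> /extension_tame[C tC].
exact: (glue_continuous (extension_samples_compatible _ _) tC).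
Qed.

Lemma energy_extend_le u (E : R) : dom_energy_above x n u ->
  energy_above x n u = E%:E ->
  (energy (extend u) <= ((bound_cst L + 1) * E)%:E)%E.
Proof.
move=> du uE; apply: energy_le => k.
rewrite (@eq_level_energy _ _ (extension b (u (q o0)) (samples u))).
  exact: level_energy_extend.
by move=> w j; exact: extendE.
Qed.

Lemma extend_above u : dom_energy_above x n u ->
  forall p, above x p -> extend u p = u p.
Proof.
move=> du; apply: (eq_on_above dx).
- by apply: continuous_subspaceW (extend_continuous du); exact: subIsetl.
- by case: du => cu _; apply: continuous_subspaceW cu; exact: subsetUl.
- move=> w aw; rewrite extendE //.
  have c := samples_compatible u.
  by case/orP: aw => h; [rewrite extension_above | rewrite extension_crossing].
Qed.

Lemma extend_linear_extension : linear_extension x n extend.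
Proof.
split=> [u du|u v du dv uv p Sp|a u v du dv p Sp|]; last exact: extend_above.
- split; first exact: extend_continuous.
  have [E _ uE] := dom_energy_above_fin du.
  by apply: le_lt_trans (energy_extend_le du uE) _; rewrite ltry.
- apply: eq_glue => w j.
  have samples_eq w' j' : above_word b w' || crossing_word b w' && (j' == o0) ->
      samples u w' j' = samples v w' j'.
    move=> h; apply: uv; left; case/orP: h => [aw|/andP[cw /eqP ->]].
      move: aw; rewrite -(cell_above _ dx) => /asboolP; apply.
      by exists (q j') => //; exact: SG_q.
    split; first exact/SG_F_word/SG_q.
    by rewrite /= (top_above _ dx) cw orbT.
  have -> : u (q o0) = v (q o0) by exact: (samples_eq [::] o0 isT).
  exact: eq_extension.
- have [C tu] := extension_tame du; have [D tv] := extension_tame dv.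
  rewrite /extend -(glue_linear a (extension_samples_compatible _ _) tu
    (extension_samples_compatible _ _) tv Sp).
  by apply: eq_glue => w j; rewrite -extension_linear.
Qed.

Lemma extend_energy_bound (B : R) : 0 <= B -> bound_cst L + 1 <= B ^+ 2 ->
  energy_bound x n extend B.
Proof.
move=> B0 hB u du; have [E E0 uE] := dom_energy_above_fin du.
have K0 : 0 <= bound_cst L + 1 :> R.
  by rewrite addr_ge0 // /bound_cst mulr_ge0 ?exprn_ge0 //; lra.
apply: (@le_trans _ _ (sqrte ((bound_cst L + 1) * E)%:E)).
  by rewrite lee_sqrt ?energy_extend_le // lee_fin mulr_ge0.
rewrite uE /= -EFinM lee_fin sqrtrM // ler_wpM2r ?sqrtr_ge0 //.
by rewrite -[leRHS]ger0_norm // -sqrtr_sqr ler_wsqrtr.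
Qed.

End AboveEnergy.
End Extension.

(** * Lower bound on the norm from a run of digits 1 *)

Section LowerBound.
Context {R : realType}.
Local Notation q := (@q R).
Variables (x : R) (b : nat -> bool) (n : nat -> nat) (k m : nat).
Hypotheses (dx : digits x b) (n_gt0 : (0 < n 0)%N).
Hypothesis n_incr : {homo n : i j / (i < j)%N}.
Hypothesis ones : forall j, (j <= m)%N -> b (k + j)%N.

(** The extended energy is at least [(5/3)^(k+m+1) / 2], the given one at most [(5/3)^k * 10/3];
    cancelling leaves the factor 4. *)
Lemma extension_norm_ge (T : (R * R -> R) -> (R * R -> R)) (B : R) :
  linear_extension x n T -> energy_bound x n T B -> (5 / 3) ^+ m <= 4 * B ^+ 2.
Proof.
move=> [Tdom _ _ Tabove] TB.
pose b' := fun j => b (k + j)%N.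
have [u su cu] := crossing_word_exists b k.
pose V : @vfamily R := graft u (jump b').
have cV : compatible V by exact/graft_compatible/jump_compatible.
have [s bs] : exists s, ~~ b' s.+1.
  have [y dy] := digits_drop k.+1 dx; have [s bs] := digits_zero dy.
  by exists s; rewrite /b' addnS.
have [C C0 hC] := @level_energy_jump R _ _ bs.
have hV j : level_energy V j <= (5 / 3) ^+ size u * C by exact: level_energy_graft.
have tV := level_energy_tame hV.
pose f := glue V.
have fE w j : f (F_word w (q j)) = V w j by exact: glueE cV tV.
have fabove j : above_energy b (samples f) j <= (5 / 3) ^+ k * (10 / 3).
  rewrite (@eq_above_energy _ _ _ V) // -su; apply: above_energy_graft => //.
  by move=> i; rewrite su; apply: above_energy_jump; exact: ones (leq0n m).
have fle := energy_above_le dx n_incr fabove.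
have fdom : dom_energy_above x n f.
  split; last exact: le_lt_trans fle (ltry _).
  apply: continuous_subspaceW (glue_continuous cV tV).
  by move=> p [] [].
have [E E0 fEE] := dom_energy_above_fin dx n_gt0 n_incr fdom.
rewrite fEE lee_fin in fle.
have [_ gfin] := Tdom f fdom.
have gabove := Tabove f fdom.
have := TB f fdom; rewrite fEE.
move: (T f) gfin gabove => g gfin gabove gB.
(* Words closing in from the left and from the right on the vertex shared by the two lower thirds of
   the cell of [u]. *)
pose w1 := u ++ o1 :: nseq m o2; pose w2 := u ++ o2 :: nseq m o1.
have top w : crossing_word b w -> g (F_word w (q o0)) = V w o0.
  move=> cw; rewrite gabove ?fE //; split; first exact/SG_F_word/SG_q.
  by rewrite /= (top_above _ dx) cw orbT.
have cross i j : i != o0 -> j != o0 -> crossing_word b (u ++ i :: nseq m j).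
  move=> i0 j0; rewrite crossing_word_cat cu andTb; apply: crossing_word_ones.
    by move=> l; rewrite /= size_nseq su; exact: ones.
  by rewrite /= i0 all_nseq /= j0 orbT.
have g1 : g (F_word w1 (q o0)) = 0 by rewrite top ?cross // /V graft_cat.
have g2 : g (F_word w2 (q o0)) = 1.
  rewrite top ?cross // /V graft_cat /= extension_crossing //.
  apply: crossing_word_ones; last by rewrite all_nseq /= orbT.
  by move=> l; rewrite size_nseq /shift /b' => lm; apply: ones.
have mid : F_word w1 (q o2) = F_word w2 (q o1).
  by rewrite /w1 /w2 !F_word_cat /= !F_word_nseq F_qC.
have := level_energy_ge2 (samples g) (w := w1) (w' := w2).
rewrite eqseq_cat // eqxx /= !size_cat /= !size_nseq => /(_ isT erefl).
rewrite su => h.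
have e1 := edge_energy_ge (samples g w1) o0 o2.
have e2 := edge_energy_ge (samples g w2) o0 o1.
rewrite /samples g1 mid in e1; rewrite /samples g2 in e2.
(* With [t] the value at the common vertex, [t^2 + (1 - t)^2 >= 1/2]. *)
have half : 1 / 2 <= edge_energy (samples g w1) + edge_energy (samples g w2).
  have := sqr_ge0 (1 - 2 * g (F_word w2 (q o1))); nra.
have gge := level_energy_le_energy g (k + m.+1).
have gf : energy g \is a fin_num.
  rewrite ge0_fin_numE //; apply: le_trans gge; rewrite lee_fin.
  exact: level_energy_ge0.
move: gB gge; rewrite -(fineK gf); set G := fine _ => /=.
rewrite -EFinM !lee_fin => gB gge.
have G0 : 0 <= G by apply: le_trans gge; exact: level_energy_ge0.
have GE : G <= B ^+ 2 * E.
  rewrite -(sqr_sqrtr G0) -(sqr_sqrtr E0) -exprMn ler_sqr ?nnegrE ?sqrtr_ge0 //.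
  exact: le_trans (sqrtr_ge0 _) gB.
have p0 : 0 < (5 / 3) ^+ k :> R by rewrite exprn_gt0 //; lra.
have l1 : (5 / 3) ^+ k * ((5 / 3) * (5 / 3) ^+ m) * (1 / 2) <= G.
  rewrite -exprS -exprD; apply: le_trans gge; apply: le_trans h.
  by rewrite ler_pM2l // exprn_gt0 //; lra.
have l2 : G <= B ^+ 2 * ((5 / 3) ^+ k * (10 / 3)).
  by apply: le_trans GE _; rewrite ler_wpM2l ?sqr_ge0.
have := le_trans l1 l2; clear -p0; move: {p0}((5 / 3) ^+ k) p0 => a a0.
by move: ((5 / 3) ^+ m) (B ^+ 2) => c d h; rewrite -(ler_pM2l a0); lra.
Qed.

End LowerBound.

(** * Both directions and the explicit bound *)

Lemma exprn_unbounded (R : realType) (M : R) : exists m, M < (5 / 3) ^+ m.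
Proof.
have [j Mj] : exists j : nat, M < j%:R.
  exists (Num.bound `|M|); apply: le_lt_trans (ler_norm M) _.
  exact: archi_boundP.
exists (2 * j)%N; apply: (lt_le_trans Mj); apply: (@le_trans _ _ (2 ^+ j)).
  by rewrite -natrX ler_nat; exact/ltnW/ltn_expl.
by rewrite exprM lerXn2r ?nnegrE //; lra.
Qed.

(** With [L = N - 1], [bound_cst L + 1] is at most [9 (10/3)^N], the square of the stated bound. *)
Lemma bounded_extension_exists (R : realType) (x : R) (n : nat -> nat) (N : nat) :
  ~ dyadic x -> binary_expansion x n -> nonconsecutive n N ->
  exists T : (R * R -> R) -> (R * R -> R),
    linear_extension x n T /\
    energy_bound x n T (3 * powR (10 / 3) (N%:R / 2)).
Proof.
move=> nd hx /nonconsecutive_runs[N0 runs].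
have dx := binary_expansion_digits nd hx; case: hx => n0 nlt _.
exists (extend (digits_of n)); split.
  exact: extend_linear_extension dx n0 nlt _ runs.
apply: (extend_energy_bound dx n0 nlt runs).
  by rewrite mulr_ge0 // powR_ge0.
rewrite exprMn -[X in _ <= _ * X]powR_mulrn ?powR_ge0 // -powRrM divfK //.
rewrite powR_mulrn; last by lra.
rewrite -[X in _ <= _ * _ ^+ X](prednK N0) [(10 / 3) ^+ _.+1]exprS /bound_cst.
have : 1 <= (10 / 3) ^+ N.-1 :> R by rewrite exprn_ege1 //; lra.
lra.
Qed.

Unset Implicit Arguments.
Theorem theorem4p6 (R : realType) :
  (forall (x : R) (n : nat -> nat),
     0 < x < 1 -> ~ dyadic x -> binary_expansion x n ->
     ((exists T : (R * R -> R) -> (R * R -> R),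
         linear_extension x n T /\ exists B : R, energy_bound x n T B) <->
      (exists N : nat, nonconsecutive n N))) /\
  (exists C : R,
     forall (x : R) (n : nat -> nat) (N : nat),
       0 < x < 1 -> ~ dyadic x -> binary_expansion x n ->
       nonconsecutive n N ->
       exists T : (R * R -> R) -> (R * R -> R),
         linear_extension x n T /\
         energy_bound x n T (C * powR (10 / 3) (N%:R / 2))).
Proof.
split; last by exists 3 => x n N _; exact: bounded_extension_exists.
move=> x n _ nd hx; split=> [[T [lT [B TB]]]|[N hN]]; last first.
  have [T [lT TB]] := bounded_extension_exists nd hx hN.
  by exists T; split => //; exists (3 * powR (10 / 3) (N%:R / 2)).
apply: contrapT => noN.
have [m hm] := exprn_unbounded (4 * B ^+ 2).
have [k hk] : exists k, forall j, (j < m.+1)%N -> exists i, n i = (k + j)%N.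
  by apply: contrapT => h; apply: noN; exists m.+1.
have dx := binary_expansion_digits nd hx; case: hx => n0 nlt _.
have k0 : (0 < k)%N.
  have [i] := hk 0%N isT; rewrite addn0 => <-.
  exact: leq_ltn_trans (increasing_lt n0 nlt i).
(* A run of exponents starting at [k] is a run of digits starting at [k.-1]. *)
have ones j : (j <= m)%N -> digits_of n (k.-1 + j)%N.
  move=> jm; apply/asboolP; have [i ni] := hk j jm; exists i.
  by rewrite ni -addSn prednK.
by have := extension_norm_ge dx n0 nlt ones lT TB; rewrite leNgt hm.
Qed.
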